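(* Let $d\ge3$ be a fixed integer and let $G_n$ be a random $d$-regular graph $\mathrm{RRG}(n,d)$, conditioned on being connected. Then for every function $\omega$ with $\omega(n)\to\infty$ as $n\to\infty$, one has $\mathbb{E}(\delta_{fp}(G_n)) = o(\omega(n))$ with high probability; that is, for every $\varepsilon>0$, $\mathbb{P}\big(\mathbb{E}(\delta_{fp}(G_n))\le \varepsilon\,\omega(n)\big)\to1$ as $n\to\infty$, the probability being over the random graph $G_n$.
   Context: $\mathrm{RRG}(n,d)$ is the uniformly random simple $d$-regular graph on $n$ labelled vertices ($nd$ even); it is connected with probability tending to 1. For a finite connected graph $G$ with shortest-path metric $d(\cdot,\cdot)$ and vertices $x,y,z,w$, let $P=d(x,y)+d(z,w)$, $Q=d(x,z)+d(y,w)$, $R=d(x,w)+d(y,z)$ and $\mathrm{fp}(x,y,z,w)=\tfrac12[\max(P,Q,R)-\mathrm{med}(P,Q,R)]$. The average hyperbolicity $\mathbb{E}(\delta_{fp}(G))$ is the expectation of $\mathrm{fp}(x,y,z,w)$ for $x,y,z,w$ i.i.d. uniform vertices of $G$; for random $G$ it is a random variable depending on $G$. *)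

(* Defs.v *)
From HB Require Import structures.
From mathcomp Require Import all_boot all_order all_algebra.
From mathcomp Require Import all_classical all_reals all_analysis.
Set Implicit Arguments.
Unset Strict Implicit.
Unset Printing Implicit Defensive.
Import Order.TTheory GRing.Theory Num.Theory.
Import numFieldNormedType.Exports.

Local Open Scope ring_scope.

Section Graphs.
Variable T : finType.

Record sgraph := SGraph {
  edges : {set {set T}};
  _ : [forall e in edges, #|e| == 2%N]
}.

HB.instance Definition _ := [isSub for edges].
HB.instance Definition _ := [Finite of sgraph by <:].

Implicit Types (G : sgraph) (x y z w : T).

Definition adj G : rel T := fun x y => [set x; y] \in edges G.

Definition regular (d : nat) G : bool :=
  [forall x, #|[set y | adj G x y]| == d].

Definition connected_graph G : bool :=
  [forall x, forall y, connect (adj G) x y].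

Definition walk_of_length G x y (k : nat) : bool :=
  [exists p : k.-tuple T, path (adj G) x p && (last x p == y)].

(* Least length of a walk from x to y. Shortest walks have length < #|T|, so
   the search range is large enough; the value is #|T| by convention when y is
   not reachable from x. *)
Definition gdist G x y : nat := find (walk_of_length G x y) (iota 0 #|T|).

End Graphs.

Definition max3 (a b c : nat) : nat := maxn a (maxn b c).

Definition med3 (a b c : nat) : nat := nth 0%N (sort leq [:: a; b; c]) 1%N.

Section Hyperbolicity.
Variables (R : realType) (T : finType).

Definition fp (G : sgraph T) (x y z w : T) : R :=
  let p := (gdist G x y + gdist G z w)%N in
  let q := (gdist G x z + gdist G y w)%N in
  let r := (gdist G x w + gdist G y z)%N in
  2^-1 * ((max3 p q r)%:R - (med3 p q r)%:R).

Definition avg_hyperbolicity (G : sgraph T) : R :=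
  (\sum_(x : T) \sum_(y : T) \sum_(z : T) \sum_(w : T) fp G x y z w)
    / (#|T| ^ 4)%:R.

End Hyperbolicity.

Arguments fp R [T] G x y z w.
Arguments avg_hyperbolicity R [T] G.

Section RandomRegularGraph.
Variables (R : realType) (n d : nat).

(* Junk value 0 when there is no d-regular graph on n vertices. *)
Definition rrg_prob (A : pred (sgraph 'I_n)) : R :=
  #|[pred G : sgraph 'I_n | regular d G & A G]|%:R
    / #|[pred G : sgraph 'I_n | regular d G]|%:R.

Definition rrg_prob_connected (A : pred (sgraph 'I_n)) : R :=
  rrg_prob [pred G | A G & connected_graph G] / rrg_prob (@connected_graph _).

End RandomRegularGraph.

Arguments rrg_prob R [n] d A.
Arguments rrg_prob_connected R [n] d A.

(* Main.v *)
(** The defect [fp x y z w] is at most half the sum of the deviations of the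
    six distances from a constant [D], so it suffices to show that the mean over
    pairs [(x, y)] of [|gdist x y - D|] is bounded with high probability, where
    [D] is the least integer with [n <= (d-1)^D].  Below [D] this is
    deterministic: there are at most [n d (d-1)^(i-1)] pairs at distance [i].

    Above [D] we use a second moment.  The number [N_L x y] of non-backtracking
    walks of length [L] from [x] to [y] has a deterministic mean
    [d (d-1)^(L-1) / n], and [\sum N_L^2] counts pairs of walks with the same
    ends; stripping the common beginning and the common end of such a pair
    leaves a closed, cyclically non-backtracking walk.  Switchings bound the
    conditional probability of an edge [uv] given a prescribed edge set.  Hence
    a walk closes two cycles with probability [O(L^4 / n^2)], while a closed
    walk that closes only one cycle runs around a simple cycle, and the rooted
    oriented simple cycles of length [m] number at most
    [(1 + O(m/n)) (d-1)^m] in mean.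
    The variance is therefore so small that a proportion at most
    [O(L^4 / n + n / (d-1)^L)] of the pairs is at distance more than [L].

    For [L = 2 D] this leaves [n] times a power of [log n] far pairs.  In a
    connected graph a geodesic of length [m] contains about [m^2] far pairs, so
    the diameter is [o(n)] and the far pairs are negligible in the mean.  A
    disconnected graph would have a union of components of polylogarithmic size,
    which the union bound over its (prescribed) induced edge set excludes. *)
Require Import Defs.
From HB Require Import structures.
From mathcomp Require Import all_boot all_order all_algebra.
From mathcomp Require Import zify ring lra.
Set Implicit Arguments.
Unset Strict Implicit.
Unset Printing Implicit Defensive.

(** * Switchings *)

Lemma card_edge (T : finType) (G : sgraph T) e : e \in edges G -> #|e| = 2.
Proof. by case: G => E /= hE eE; apply/eqP; move/forallP/(_ e)/implyP: hE; apply. Qed.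

Lemma adj_irr (T : finType) (G : sgraph T) x : adj G x x = false.
Proof. by apply/negP => /card_edge; rewrite setUid cards1. Qed.

Lemma adj_sym (T : finType) (G : sgraph T) x y : adj G x y = adj G y x.
Proof. by rewrite /adj setUC. Qed.

Lemma adj_neq (T : finType) (G : sgraph T) x y : adj G x y -> x != y.
Proof. by apply: contraTneq => ->; rewrite adj_irr. Qed.

Lemma card_nbr (T : finType) (G : sgraph T) d x :
  regular d G -> #|[set y | adj G x y]| = d.
Proof. by move/forallP/(_ x)/eqP. Qed.

Lemma eq_set2 (T : finType) (a b c e : T) :
  ([set a; b] == [set c; e]) = ((a == c) && (b == e)) || ((a == e) && (b == c)).
Proof.
apply/eqP/idP.
  move=> E.
  have ha : a \in [set c; e] by rewrite -E !inE eqxx.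
  have hb : b \in [set c; e] by rewrite -E !inE eqxx orbT.
  have hc : c \in [set a; b] by rewrite E !inE eqxx.
  have he : e \in [set a; b] by rewrite E !inE eqxx orbT.
  move: ha hb hc he; rewrite !inE !(eq_sym c) !(eq_sym e).
  by do 4 ![case: eqVneq => ? //=; subst].
by case/orP => /andP [/eqP -> /eqP ->] //; rewrite setUC.
Qed.

Section Switching.
Variables (T : finType) (d : nat).
Local Notation n := #|T|.
Implicit Types (G : sgraph T) (H E : {set {set T}}) (u v a b x y z : T).

Definition edeg H x := #|[set y | [set x; y] \in H]|.

Definition switch_edges E u v a b : {set {set T}} :=
  (E :\ [set u; v] :\ [set a; b]) :|: [set [set u; a]; [set v; b]].

Definition switch_ok E u v a b :=
  [&& [set u; v] \in E, [set a; b] \in E, a != u, b != v,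
      [set u; a] \notin E & [set v; b] \notin E].

Lemma switch_simple G u v a b : switch_ok (edges G) u v a b ->
  [forall e in switch_edges (edges G) u v a b, #|e| == 2].
Proof.
case/and5P => uvE abE au bv _; apply/forallP => e; apply/implyP.
rewrite !inE => /orP [/and3P [_ _ /card_edge -> //]|].
by case/orP => /eqP ->; rewrite cards2 eqSS eqb1 eq_sym ?au ?bv.
Qed.

(** Made total by returning [G] when the switching is not admissible; the reflected boolean supplies
    the proof of simplicity that [SGraph] requires. *)
Definition switch G u v a b : sgraph T :=
  if @idP (switch_ok (edges G) u v a b) is ReflectT h
  then SGraph (switch_simple h) else G.

Lemma edges_switch G u v a b : switch_ok (edges G) u v a b ->
  edges (switch G u v a b) = switch_edges (edges G) u v a b.
Proof. by rewrite /switch; case: {-}_ / idP => // h. Qed.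

Lemma switch_distinct G u v a b : switch_ok (edges G) u v a b ->
  [&& u != v, a != b, a != u, b != v, a != v & b != u].
Proof.
case/and5P => uvE abE au bv /andP [uaE vbE].
rewrite (adj_neq uvE) (adj_neq abE) au bv /=.
apply/andP; split; first by apply: contraNneq uaE => ->.
by apply: contraNneq vbE => ->; rewrite setUC.
Qed.

(** Each of the ends [u], [v], [a], [b] loses one neighbour and gains one that it did not have; no
    other neighbourhood changes. *)
Lemma switch_regular G u v a b : switch_ok (edges G) u v a b ->
  regular d G -> regular d (switch G u v a b).
Proof.
move=> ok /forallP reg; have := switch_distinct ok.
case/and5P => uv ab au bv /andP [av bu].
apply/forallP => z; rewrite -(eqP (reg z)).
case/and5P: (ok) => uvE abE _ _ /andP [uaE vbE].
have swapcard p r : adj G z p -> ~~ adj G z r ->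
    #|r |: ([set y | adj G z y] :\ p)| = #|[set y | adj G z y]|.
  move=> zp zr; rewrite cardsU1 !inE (negbTE zr) andbF /=.
  by rewrite [in RHS](cardsD1 p) inE zp.
have nb y : adj (switch G u v a b) z y =
    ([set z; y] != [set a; b]) && ([set z; y] != [set u; v]) && adj G z y
    || ([set z; y] == [set u; a]) || ([set z; y] == [set v; b]).
  by rewrite /adj edges_switch // /switch_edges !inE andbA orbA.
have [zu|zu] := eqVneq z u; first subst z.
  apply/eqP; rewrite -(swapcard v a) //; congr #|pred_of_set _|.
  apply/setP => y; rewrite !inE nb !eq_set2 !eqxx /=.
  rewrite (negbTE uv) /= (eq_sym u) (negbTE au) /= (eq_sym u) (negbTE bu) /=.
  by rewrite orbF /=; case: (eqVneq y a) => //=; rewrite ?orbT ?orbF.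
have [zv|zv] := eqVneq z v; first subst z.
  apply/eqP; rewrite -(swapcard u b) //; last by rewrite adj_sym.
  congr #|pred_of_set _|.
  apply/setP => y; rewrite !inE nb !eq_set2 !eqxx /=.
  rewrite (eq_sym v u) (negbTE uv) /= (eq_sym v a) (negbTE av) /= (eq_sym v b) (negbTE bv) /=.
  by rewrite !orbF /= orbC.
have [za|za] := eqVneq z a; first subst z.
  apply/eqP; rewrite -(swapcard b u) //; last by rewrite adj_sym.
  congr #|pred_of_set _|.
  apply/setP => y; rewrite !inE nb !eq_set2 !eqxx /=.
  rewrite (negbTE ab) (negbTE au) (negbTE av) /=.
  by rewrite !orbF andbT orbC.
have [zb|zb] := eqVneq z b; first subst z.
  apply/eqP; rewrite -(swapcard a v) //; try by rewrite adj_sym.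
  congr #|pred_of_set _|.
  apply/setP => y; rewrite !inE nb !eq_set2 !eqxx /=.
  rewrite (eq_sym b a) (negbTE ab) (negbTE bu) (negbTE bv) /=.
  by rewrite !orbF andbT orbC.
apply/eqP; congr #|pred_of_set _|; apply/setP => y; rewrite !inE nb !eq_set2.
by rewrite (negbTE zu) (negbTE zv) (negbTE za) (negbTE zb) /= !orbF.
Qed.

(** Exchanging the two pairs of edges back recovers [G], so for fixed [u v a b] the switching is
    injective. *)
Lemma switch_inv G u v a b : switch_ok (edges G) u v a b ->
  edges G = (switch_edges (edges G) u v a b :\ [set u; a] :\ [set v; b])
            :|: [set [set u; v]; [set a; b]].
Proof.
move=> ok; case/and5P: (ok) => uvE abE _ _ /andP [uaE vbE].
apply/setP => e; rewrite !inE.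
case: (eqVneq e [set v; b]) => [->|] /=.
  rewrite (negbTE vbE); apply/esym/negbTE; rewrite negb_or.
  by rewrite !(contraNneq _ vbE) => // ->.
case: (eqVneq e [set u; a]) => [->|] /=.
  rewrite (negbTE uaE) => _; apply/esym/negbTE; rewrite negb_or.
  by rewrite !(contraNneq _ uaE) => // ->.
move=> _ _; rewrite !orbF.
case: (eqVneq e [set u; v]) => [->|] /=; first by rewrite uvE orbT.
by case: (eqVneq e [set a; b]) => [->|]; rewrite ?abE ?orbF.
Qed.

(** Divided by the number of regular graphs, [#|regs H|] is the probability that the random graph
    contains [H]; probabilities are handled as such cardinals. *)
Definition regs H : {set sgraph T} := [set G | regular d G & H \subset edges G].

Lemma sum_card_pair (A : {set sgraph T}) (Q : sgraph T -> T -> T -> bool) :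
  #|[set p : sgraph T * (T * T) | (p.1 \in A) && Q p.1 p.2.1 p.2.2]|
  = \sum_(G in A) #|[set p : T * T | Q G p.1 p.2]|.
Proof.
rewrite -sum1dep_card [RHS](eq_bigr (fun G => \sum_(p | Q G p.1 p.2) 1));
  last by move=> G _; rewrite sum1dep_card.
by rewrite pair_big_dep.
Qed.

Lemma card_arcs G : regular d G ->
  #|[set p : T * T | adj G p.1 p.2]| = n * d.
Proof.
move=> reg; rewrite -sum1dep_card -(pair_big_dep xpredT (adj G) (fun _ _ => 1)) /=.
rewrite (eq_bigr (fun=> d)) ?sum_nat_const // => x _.
by rewrite sum1dep_card (card_nbr _ reg).
Qed.

Lemma card_arcs_in H : [forall e in H, #|e| == 2] ->
  #|[set p : T * T | [set p.1; p.2] \in H]| <= 2 * #|H|.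
Proof.
move=> simpleH; rewrite -sum1dep_card.
rewrite (partition_big (fun p : T * T => [set p.1; p.2]) (mem H)) //=.
rewrite mulnC -sum_nat_const; apply: leq_sum => e eH.
have /cards2P [x [y [xy ->]]] : #|e| == 2.
  by move/forallP/(_ e)/implyP: simpleH; apply.
rewrite sum1dep_card (@leq_trans #|[set (x, y); (y, x)]|) //; last first.
  by rewrite cards2; case: (_ != _).
apply/subset_leq_card/subsetP => -[p r]; rewrite !inE /= eq_set2 => /andP [_].
by rewrite -!pair_eqE.
Qed.

Lemma card_ball1_arcs G x : regular d G ->
  #|[set p : T * T | adj G p.1 p.2 & (p.1 == x) || adj G x p.1]| <= d * d.+1.
Proof.
move=> reg; rewrite -sum1dep_card.
rewrite (eq_bigl (fun p => ((p.1 == x) || adj G x p.1) && adj G p.1 p.2)); last first.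
  by move=> p; rewrite andbC.
rewrite -(pair_big_dep (fun y => (y == x) || adj G x y) (adj G) (fun _ _ => 1)) /=.
rewrite (eq_bigr (fun=> d)) => [|y _]; last by rewrite sum1dep_card (card_nbr _ reg).
rewrite sum_nat_cond_const mulnC leq_mul2l; apply/orP; right.
have -> : [set i | (i == x) || adj G x i] = x |: [set y | adj G x y].
  by apply/setP => y; rewrite !inE.
by rewrite cardsU1 (card_nbr _ reg) !inE adj_irr.
Qed.

(** Of the [n * d] arcs [(a, b)], those that spoil the switching lie on [H], start in the closed
    unit ball of [u], or end in that of [v]; each ball accounts for at most [d * d.+1] arcs. *)
Lemma switch_count_low G H u v : regular d G -> H \subset edges G ->
  [set u; v] \in edges G ->
  n * d - 2 * #|H| - 2 * (d * d.+1) <=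
  #|[set p : T * T | switch_ok (edges G) u v p.1 p.2 && ([set p.1; p.2] \notin H)]|.
Proof.
move=> reg HG uvG.
set A := [set p : T * T | adj G p.1 p.2].
set B1 := [set p : T * T | [set p.1; p.2] \in H].
set B2 := [set p : T * T | adj G p.1 p.2 & (p.1 == u) || adj G u p.1].
set B3 := [set p : T * T | adj G p.2 p.1 & (p.2 == v) || adj G v p.2].
have simpleH : [forall e in H, #|e| == 2].
  apply/forallP => e; apply/implyP => eH; apply/eqP; apply: card_edge.
  exact: (subsetP HG).
have c1 : #|B1| <= 2 * #|H| by apply: card_arcs_in.
have c2 : #|B2| <= d * d.+1 by apply: card_ball1_arcs.
have c3 : #|B3| <= d * d.+1.
  rewrite (leq_trans _ (card_ball1_arcs v reg)) //.
  rewrite -(card_imset (pred_of_set B3) (f := fun p : T * T => (p.2, p.1))); last first.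
    by move=> [? ?] [? ?] [-> ->].
  apply/subset_leq_card/subsetP => _ /imsetP [[a b] /[swap] -> ].
  by rewrite !inE.
have cA : #|A| = n * d by apply: card_arcs.
have sub : A :\: (B1 :|: B2 :|: B3) \subset
    [set p : T * T | switch_ok (edges G) u v p.1 p.2 && ([set p.1; p.2] \notin H)].
  apply/subsetP => -[a b]; rewrite !inE /= /switch_ok uvG /= (adj_sym G b a).
  rewrite /adj.
  case: ([set a; b] \in edges G); rewrite ?andbF //= !negb_or.
  by rewrite !andbT -!andbA => /and5P [-> -> -> -> ->].
have := subset_leq_card sub; apply: leq_trans.
have := cardsD A (B1 :|: B2 :|: B3).
have : #|A :&: (B1 :|: B2 :|: B3)| <= #|B1 :|: B2 :|: B3|.
  exact/subset_leq_card/subsetIr.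
have := cardsU (B1 :|: B2) B3; have := cardsU B1 B2.
lia.
Qed.

Lemma card_free_nbr G H u : regular d G -> H \subset edges G ->
  #|[set a | adj G u a & [set u; a] \notin H]| = d - edeg H u.
Proof.
move=> reg HG; rewrite -(card_nbr u reg) /edeg.
have -> : [set a | adj G u a & [set u; a] \notin H] =
   [set y | adj G u y] :\: [set y | [set u; y] \in H].
  by apply/setP => a; rewrite !inE andbC.
rewrite cardsD; congr (_ - #|pred_of_set _|); apply/setP => a; rewrite !inE.
by case: (boolP (_ \in H)); rewrite ?andbF // => /(subsetP HG) h; rewrite andbT.
Qed.

(* Double counting of the switchings G -> G - uv - ab + ua + vb. *)
Lemma switching H u v : [set u; v] \notin H ->
  #|regs ([set u; v] |: H)| * (n * d - 2 * #|H| - 2 * (d * d.+1)) <=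
  #|regs H| * ((d - edeg H u) * (d - edeg H v)).
Proof.
move=> uvH.
(* [Q1] describes the switchings leaving a graph, [Q2] the trace left in the image: [ua] and [vb]
   are edges outside [H], because they were absent from a graph containing [H]. *)
set Q1 := fun G a b => switch_ok (edges G) u v a b && ([set a; b] \notin H).
set Q2 := fun G a b => (adj G u a && ([set u; a] \notin H))
                       && (adj G v b && ([set v; b] \notin H)).
apply: (@leq_trans #|[set p : sgraph T * (T * T) |
   (p.1 \in regs ([set u; v] |: H)) && Q1 p.1 p.2.1 p.2.2]|).
  rewrite sum_card_pair -sum_nat_const leq_sum // => G.
  rewrite inE subUset sub1set => /and3P [reg uvG HG].
  exact: switch_count_low.
apply: (@leq_trans #|[set p : sgraph T * (T * T) |
   (p.1 \in regs H) && Q2 p.1 p.2.1 p.2.2]|); last first.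
  rewrite sum_card_pair -sum_nat_const leq_sum // => G.
  rewrite inE => /andP [reg HG]; rewrite -!(card_free_nbr _ reg HG) -cardsX.
  by apply/subset_leq_card/subsetP => -[a b]; rewrite !inE.
pose f (p : sgraph T * (T * T)) := (switch p.1 u v p.2.1 p.2.2, p.2).
set A := [set p | _]; rewrite -(@card_in_imset _ _ f A); last first.
  move=> [G1 [a1 b1]] [G2 [a2 b2]]; rewrite !inE /Q1 /=.
  case/andP=> _ /andP [ok1 _]; case/andP=> _ /andP [ok2 _] [E ea eb].
  subst a2 b2; congr (_, _); apply/val_inj => /=.
  have := congr1 (@edges T) E; rewrite !edges_switch // => E'.
  by rewrite (switch_inv ok1) E' -switch_inv.
apply/subset_leq_card/subsetP => _ /imsetP [[G [a b]] /[swap] ->].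
rewrite !inE /Q1 /Q2 /= subUset sub1set.
case/andP => /and3P [reg uvG HG] /andP [ok abH].
rewrite switch_regular //= /adj !edges_switch // /switch_edges !inE !eqxx !orbT /=.
case/and5P: (ok) => _ abE _ _ /andP [uaE vbE].
rewrite !(contraNN (subsetP HG _)) //= !andbT.
apply/subsetP => e eH; rewrite !inE (subsetP HG) // andbT.
by rewrite (contraNneq _ abH) ?(contraNneq _ uvH) // => <-.
Qed.

(** While [H] is small, at least half of the [n * d] arcs remain available, so a further edge has
    conditional probability at most [2 * d / n]. *)
Lemma switching_crude H u v : 0 < d -> [set u; v] \notin H ->
  2 * (2 * #|H| + 2 * (d * d.+1)) <= n * d ->
  n * #|regs ([set u; v] |: H)| <= 2 * d * #|regs H|.
Proof.
move=> d0 uvH big; have := switching uvH.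
set a := #|regs _|; set b := #|regs H| => h.
have : a * (n * d) <= 2 * (b * (d * d)).
  apply: (@leq_trans (2 * (a * (n * d - 2 * #|H| - 2 * (d * d.+1))))).
    rewrite [leqRHS]mulnCA leq_mul2l; apply/orP; right; lia.
  rewrite leq_mul2l /=; apply: (leq_trans h).
  by rewrite leq_mul2l leq_mul ?leq_subr ?orbT.
by move=> {}h; rewrite -(leq_pmul2r d0); lia.
Qed.

End Switching.

(** * Non-backtracking walks and collisions *)

Lemma sum_tuple_cons (T : finType) k (F : seq T -> nat) :
  \sum_(t : k.+1.-tuple T) F t = \sum_(t : k.-tuple T) \sum_(u : T) F (u :: t).
Proof.
rewrite pair_big /=.
rewrite (reindex (fun p : k.-tuple T * T => [tuple of p.2 :: p.1])) /=; last first.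
  exists (fun t : k.+1.-tuple T => ([tuple of behead t], thead t)) => [[t u] _|t _].
    by congr (_, _); apply/val_inj.
  by rewrite /= -tuple_eta.
by apply: eq_bigr.
Qed.

Lemma sum_tuple0 (T : finType) (F : seq T -> nat) :
  \sum_(t : 0.-tuple T) F t = F [::].
Proof.
rewrite (bigD1 [tuple]) //= big1 ?addn0 // => t /eqP[]; exact: tuple0.
Qed.

Section Walks.
Variables (T : finType) (d : nat).
Local Notation n := #|T|.
Local Notation q := d.-1.
Implicit Types (G : sgraph T) (u v x y : T) (s : seq T).

Fixpoint walk_edges s : seq {set T} :=
  if s is x :: ((y :: _) as s') then [set x; y] :: walk_edges s' else [::].

Definition wedges s : {set {set T}} := [set e in walk_edges s].

Fixpoint nonback s :=
  if s is x :: s' then (ohead (behead s') != Some x) && nonback s' else true.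

Definition nbwalk G s := sorted (adj G) s && nonback s.

(** Reaching an old vertex along a new edge is the move that adds an independent cycle to the
    subgraph traced so far. *)
Definition collision s :=
  if s is x :: ((y :: _) as s')
  then (x \in s') && ([set x; y] \notin walk_edges s') else false.

(* Walks are read from the right: the head of the sequence is the last vertex
   reached. *)
Fixpoint ncoll s : nat := if s is _ :: s' then collision s + ncoll s' else 0.

Local Arguments collision : simpl never.

Lemma wedges_cons2 x y s : wedges (x :: y :: s) = [set x; y] |: wedges (y :: s).
Proof. by apply/setP => e; rewrite !inE. Qed.

Lemma wedges1 x : wedges [:: x] = set0.
Proof. by apply/setP => e; rewrite !inE. Qed.

Lemma sorted_wedges G s : sorted (adj G) s = (wedges s \subset edges G).
Proof.
elim: s => [|x [|y s] IH]; rewrite ?wedges1 ?sub0set //.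
by rewrite wedges_cons2 subUset sub1set -IH.
Qed.

Lemma mem_regs G s : (G \in regs d (wedges s)) = regular d G && sorted (adj G) s.
Proof. by rewrite inE sorted_wedges. Qed.

Lemma card_wedges s : #|wedges s| <= (size s).-1.
Proof.
rewrite cardsE (leq_trans (card_size _)) //.
by elim: s => [|x [|y s] IH].
Qed.

Lemma mem_walk_edges e x s : e \in walk_edges s -> x \in e -> x \in s.
Proof.
elim: s => [|y [|z s] IH] //; rewrite inE => /orP [/eqP -> |/IH h /h].
  by rewrite !inE => /orP [->|/eqP ->]; rewrite ?eqxx ?orbT.
by rewrite [in X in _ -> X]inE => ->; rewrite orbT.
Qed.

Lemma nonbackP x0 s :
  reflect (forall i, i.+2 < size s -> nth x0 s i != nth x0 s i.+2) (nonback s).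
Proof.
elim: s => [|x s IH] /=; first by constructor.
apply: (iffP andP) => [[h /IH hs] [|i] hi|h].
- by case: s h hi {IH hs} => [|a [|b s]] //= h _; apply: contraNneq h => ->.
- exact: hs.
split; last by apply/IH => i hi; apply: (h i.+1).
by case: s h {IH} => [|a [|b s]] // /(_ 0 isT) /=; apply: contraNneq => -[->].
Qed.

Lemma nonback_rev s : nonback (rev s) = nonback s.
Proof.
suff imp s' : nonback s' -> nonback (rev s').
  by apply/idP/idP => [/imp|/imp //]; rewrite revK.
case: s' => // x0 s'; move: (x0 :: s') => t /(nonbackP x0) h.
apply/(nonbackP x0) => i; rewrite size_rev => hi.
rewrite !nth_rev //; last by apply: leq_trans hi; rewrite leqW.
rewrite eq_sym.
have -> : size t - i.+1 = (size t - i.+3).+2 by lia.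
by apply: h; lia.
Qed.

Lemma sorted_adj_rev G s : sorted (adj G) (rev s) = sorted (adj G) s.
Proof. by rewrite rev_sorted; apply: eq_sorted => x y; rewrite adj_sym. Qed.

Lemma nbwalk_rev G s : nbwalk G (rev s) = nbwalk G s.
Proof. by rewrite /nbwalk nonback_rev sorted_adj_rev. Qed.

Lemma nbwalk_cons2 G x y z s : nbwalk G [:: x, y, z & s] =
  [&& adj G x y, z != x & nbwalk G [:: y, z & s]].
Proof. by rewrite /nbwalk /= -!andbA; do !bool_congr. Qed.

Lemma sum_nbwalk_cons G s : regular d G -> 1 < size s ->
  \sum_(u : T) nbwalk G (u :: s) = q * nbwalk G s.
Proof.
case: s => [|y [|z s]] // reg _.
under eq_bigr do rewrite nbwalk_cons2.
have [nbs|_] := boolP (nbwalk G _); last first.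
  by rewrite muln0 big1 // => u _; rewrite !andbF.
have yz : adj G y z by case/andP: nbs => /= /andP [].
rewrite muln1; transitivity (\sum_(u | u \in [set u | adj G y u] :\ z) 1).
  by rewrite [RHS]big_mkcond /=; apply: eq_bigr => u _; rewrite !inE adj_sym eq_sym andbT andbC; case: andb.
by rewrite sum1_card -(card_nbr y reg) (cardsD1 z [set u | _]) inE yz.
Qed.

Lemma sum_nbwalk G k : regular d G ->
  \sum_(s : k.+2.-tuple T) nbwalk G s = n * d * q ^ k.
Proof.
move=> reg; elim: k => [|k IH].
  rewrite muln1 (@sum_tuple_cons _ _ (fun s => nbwalk G s)).
  rewrite (@sum_tuple_cons _ _ (fun s => \sum_u nbwalk G (u :: s))).
  rewrite (@sum_tuple0 _ (fun s => \sum_v \sum_u nbwalk G (u :: v :: s))).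
  rewrite -sum_nat_const; apply: eq_bigr => x _.
  rewrite -(card_nbr x reg) -sum1dep_card [RHS]big_mkcond /=; apply: eq_bigr => y _.
  by rewrite /nbwalk /= !andbT adj_sym; case: adj.
rewrite (@sum_tuple_cons _ _ (fun s => nbwalk G s)).
rewrite (eq_bigr (fun s : k.+2.-tuple T => q * nbwalk G s)) => [|s _]; last first.
  by rewrite sum_nbwalk_cons // size_tuple.
by rewrite -big_distrr IH expnS /=; lia.
Qed.

Local Notation N := #|[set G : sgraph T | regular d G]|.

(** Counts pairs of a regular graph and a non-backtracking walk in it with at least [j] collisions.
    Fixing the vertex sequence first lets a collision be charged to a prescribed edge set. *)
Definition coll_count j k :=
  \sum_(s : k.-tuple T) (nonback s && (j <= ncoll s)) * #|regs d (wedges s)|.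

Lemma sum_regs_cons s : 1 < size s ->
  \sum_(u : T) nonback (u :: s) * #|regs d (wedges (u :: s))| =
  q * (nonback s * #|regs d (wedges s)|).
Proof.
move=> sz.
have E t : nonback t * #|regs d (wedges t)| = \sum_(G | regular d G) nbwalk G t.
  rewrite -sum1_card big_distrr /=.
  rewrite (eq_bigl (fun G => regular d G && sorted (adj G) t)); last first.
    by move=> G; rewrite mem_regs.
  rewrite big_mkcondr /=; apply: eq_bigr => G _.
  by rewrite /nbwalk; case: sorted; rewrite ?muln1.
rewrite E; under eq_bigr do rewrite E.
rewrite exchange_big big_distrr /=; apply: eq_bigr => G reg.
exact: sum_nbwalk_cons.
Qed.

Lemma coll_count0 k : coll_count 0 k.+2 = N * (n * d * q ^ k).
Proof.
rewrite -sum_nat_cond_const (eq_bigr (fun G => \sum_(s : k.+2.-tuple T) nbwalk G s));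
  last by move=> G reg; rewrite sum_nbwalk.
rewrite exchange_big; apply: eq_bigr => s _.
rewrite -sum1_card big_distrr /=.
rewrite (eq_bigl (fun G => regular d G && sorted (adj G) s)); last first.
  by move=> G; rewrite mem_regs.
rewrite big_mkcondr /=; apply: eq_bigr => G _.
by rewrite /nbwalk andbT; case: sorted; rewrite ?muln1.
Qed.

(** A colliding step has at most [size s] old vertices to choose from, and the new edge to each
    costs a factor [2 * d / n] by [switching_crude]. *)
Lemma sum_collision s : 0 < d -> 
  2 * (2 * (size s).-1 + 2 * (d * d.+1)) <= n * d ->
  n * \sum_(u : T) collision (u :: s) * #|regs d (wedges (u :: s))| <=
  2 * d * size s * #|regs d (wedges s)|.
Proof.
move=> d0 big; case: s big => [|v s] big.
  by rewrite big1 ?muln0 // => u _; rewrite mul0n.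
apply: (@leq_trans (\sum_(u in v :: s) 2 * d * #|regs d (wedges (v :: s))|)); last first.
  rewrite sum_nat_const mulnA leq_mul2r; apply/orP; right.
  by rewrite mulnC leq_mul2l card_size orbT.
rewrite big_distrr /= [leqRHS]big_mkcond /=; apply: leq_sum => u _.
rewrite (_ : collision (u :: v :: s) =
  (u \in v :: s) && ([set u; v] \notin walk_edges (v :: s))) //.
case: (u \in v :: s); last by rewrite muln0.
case: (boolP ([set u; v] \in _)) => uvs; first by rewrite muln0.
rewrite mul1n wedges_cons2 switching_crude //; first by rewrite inE.
by have := card_wedges (v :: s); move: big => /=; lia.
Qed.

(** Either [j.+1] collisions occurred before the last step, which then has at most [q] choices, or
    exactly [j] did and the last step collides. *)
Lemma coll_countS j k : 0 < d ->
  2 * (2 * k.+1 + 2 * (d * d.+1)) <= n * d ->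
  n * coll_count j.+1 k.+3 <=
  q * (n * coll_count j.+1 k.+2) + 2 * d * k.+2 * coll_count j k.+2.
Proof.
move=> d0 big.
rewrite /coll_count.
rewrite (@sum_tuple_cons _ _ (fun s => (nonback s && (j.+1 <= ncoll s)) * #|regs d (wedges s)|)).
rewrite mulnCA !big_distrr -big_split /=; apply: leq_sum => s _.
have sz : size s = k.+2 by rewrite size_tuple.
have := @sum_regs_cons s; have := @sum_collision s; rewrite sz => /(_ d0 big) h1 /(_ isT) h2.
case: (boolP (nonback s)) h2 => [nbs|_] h2; last first.
  by rewrite big1 ?muln0 // => u _; rewrite /= andbF.
case: (boolP (j < ncoll s)) => jn /=.
  apply: leq_trans (leq_addr _ _).
  rewrite leq_mul2l; apply/orP; right.
  rewrite -h2; apply: leq_sum => u _ /=.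
  by rewrite leq_mul2r nbs; apply/orP; right; case: (_ != _) => //=; exact: leq_b1.
rewrite mul0n !muln0 add0n.
case: (ltnP (ncoll s) j) => jn2 /=.
  rewrite big1 ?muln0 // => u _; rewrite andbT.
  by case: (collision _) => /=; rewrite (_ : j < _ = false) ?andbF //; lia.
rewrite mul1n; apply: leq_trans h1; rewrite leq_mul2l; apply/orP; right.
apply: leq_sum => u _; rewrite leq_mul2r; apply/orP; right => /=.
case: (collision _) => /=; first by case: (_ && _).
by rewrite add0n (negbTE jn) andbF.
Qed.

Lemma coll_count_base j : coll_count j.+1 2 = 0.
Proof.
rewrite /coll_count big1 // => -[[|u [|v [|]]] //= _] _.
(* The only possible collision is [u = v], and then the singleton [[set v; v]] would have to be an
   edge. *)
case: (eqVneq u v) => [->|uv] /=; last by rewrite /collision mem_seq1 (negbTE uv) ltn0.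
rewrite wedges_cons2 (_ : regs d _ = set0) ?cards0 ?muln0 //.
apply/setP => G; rewrite !inE subUset sub1set.
by move: (adj_irr G v); rewrite /adj => ->; rewrite andbF.
Qed.

Lemma coll_count1 k : 1 < d ->
  2 * (2 * k.+1 + 2 * (d * d.+1)) <= n * d ->
  n * coll_count 1 k.+2 <= 2 * d * k.+2 ^ 2 * (N * (n * d * q ^ k)).
Proof.
move=> d1; elim: k => [|k IH] big; first by rewrite coll_count_base muln0.
have d0 : 0 < d by rewrite ltnW.
have q0 : 0 < q by rewrite -subn1 subn_gt0.
have bigk : 2 * (2 * k.+1 + 2 * (d * d.+1)) <= n * d by lia.
have := @coll_countS 0 k d0 bigk; rewrite coll_count0.
have {IH} := IH bigk; rewrite (expnS q); set B := N * (n * d * q ^ k).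
have -> : N * (n * d * (q * q ^ k)) = q * B by rewrite /B; lia.
set X := n * coll_count 1 k.+2 => IH h; apply: (leq_trans h).
apply: (@leq_trans (q * (2 * d * k.+2 ^ 2 * B) + 2 * d * k.+2 * (q * B))).
  apply: leq_add; first by rewrite leq_mul2l IH orbT.
  by rewrite leq_mul2l leq_pmull ?orbT.
have -> : q * (2 * d * k.+2 ^ 2 * B) + 2 * d * k.+2 * (q * B) =
  2 * d * (k.+2 ^ 2 + k.+2) * (q * B) by ring.
by rewrite leq_mul2r leq_mul2l; apply/orP; right; apply/orP; right; nia.
Qed.

(** Running the recursion once more squares the factor [2 * d * k.+2 ^ 2] of [coll_count1]: two
    collisions have probability of order [k ^ 4 / n ^ 2]. *)
Lemma coll_count2 k : 1 < d ->
  2 * (2 * k.+1 + 2 * (d * d.+1)) <= n * d ->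
  n ^ 2 * coll_count 2 k.+2 <= (2 * d) ^ 2 * k.+2 ^ 4 * (N * (n * d * q ^ k)).
Proof.
move=> d1; elim: k => [|k IH] big; first by rewrite coll_count_base muln0.
have d0 : 0 < d by rewrite ltnW.
have q0 : 0 < q by rewrite -subn1 subn_gt0.
have bigk : 2 * (2 * k.+1 + 2 * (d * d.+1)) <= n * d by lia.
have := @coll_countS 1 k d0 bigk; have := coll_count1 d1 bigk.
have {IH} := IH bigk; rewrite (expnS q); set B := N * (n * d * q ^ k).
have -> : N * (n * d * (q * q ^ k)) = q * B by rewrite /B; lia.
set c2 := coll_count 2 k.+2; set c1 := coll_count 1 k.+2 => h2 h1 h.
have -> : n ^ 2 * coll_count 2 k.+3 = n * (n * coll_count 2 k.+3) by rewrite mulnA.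
apply: (@leq_trans (n * (q * (n * c2) + 2 * d * k.+2 * c1))).
  by rewrite leq_mul2l h orbT.
have -> : n * (q * (n * c2) + 2 * d * k.+2 * c1) =
          q * (n ^ 2 * c2) + 2 * d * k.+2 * (n * c1) by ring.
apply: (@leq_trans (q * ((2 * d) ^ 2 * k.+2 ^ 4 * B) +
                    2 * d * k.+2 * (2 * d * k.+2 ^ 2 * (q * B)))).
  apply: leq_add; first by rewrite leq_mul2l h2 orbT.
  rewrite leq_mul2l; apply/orP; right; apply: (leq_trans h1).
  by rewrite leq_mul2l leq_pmull ?orbT.
have -> : q * ((2 * d) ^ 2 * k.+2 ^ 4 * B) +
     2 * d * k.+2 * (2 * d * k.+2 ^ 2 * (q * B)) =
  (2 * d) ^ 2 * (k.+2 ^ 4 + k.+2 ^ 3) * (q * B) by ring.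
rewrite leq_mul2r leq_mul2l; apply/orP; right; apply/orP; right.
by rewrite !expnS !expn0; nia.
Qed.

End Walks.

Arguments collision {T} s : simpl never.

(** * Closed walks with one collision *)

Section ClosedWalks.
Variables (T : finType).
Implicit Types (G : sgraph T) (u x y : T) (s c : seq T) (v : nat -> T).

(** Walks are stored last vertex first; [hist] builds one from a function of time, so that arguments
    can be indexed chronologically. *)
Fixpoint hist v k := if k is k'.+1 then v k' :: hist v k' else [::].

Lemma size_hist v k : size (hist v k) = k.
Proof. by elim: k => //= k ->. Qed.

Lemma eq_hist v w k : (forall i, i < k -> v i = w i) -> hist v k = hist w k.
Proof.
elim: k => //= k IH h; rewrite h // IH // => i ik.
by apply: h; rewrite ltnW.
Qed.

Lemma hist_nth x0 s : hist (nth x0 (rev s)) (size s) = s.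
Proof.
elim: s => //= x s IH; rewrite nth_rev /= ?subSS ?subnn //; congr (_ :: _).
rewrite -[RHS]IH; apply: eq_hist => i ik.
by rewrite rev_cons nth_rcons size_rev ik.
Qed.

Lemma nth_rev_hist x0 v k i : i < k -> nth x0 (rev (hist v k)) i = v i.
Proof.
elim: k => //= k IH; rewrite rev_cons nth_rcons size_rev size_hist ltnS leq_eqVlt.
by case: (ltngtP i k) => // [ik|->] _; rewrite ?IH.
Qed.

Lemma mem_histP v k u : reflect (exists2 j, j < k & u = v j) (u \in hist v k).
Proof.
elim: k => /= [|k IH]; first by constructor; case.
rewrite inE; apply: (iffP orP) => [[/eqP ->|/IH [j jk ->]]|[j jk ej]].
- by exists k.
- by exists j; rewrite // ltnW.
- move: jk; rewrite ltnS leq_eqVlt => /orP [/eqP jE|jk]; first by left; rewrite ej jE.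
  by right; apply/IH; exists j.
Qed.

Lemma edges_histP v k e :
  reflect (exists2 j, j.+1 < k & e = [set v j.+1; v j]) (e \in walk_edges (hist v k)).
Proof.
case: k => [|k] /=; first by constructor; case.
elim: k => [|k IH] /=; first by constructor; case.
rewrite inE; apply: (iffP orP) => [[/eqP ->|/IH [j jk ->]]|[j jk ej]].
- by exists k.
- by exists j; rewrite // ltnW.
- move: jk; rewrite 2!ltnS leq_eqVlt => /orP [/eqP jE|jk]; first by left; rewrite ej jE.
  by right; apply/IH; exists j.
Qed.

Lemma ncoll_hist1 v k i j : ncoll (hist v k) <= 1 -> i < j -> j.+2 <= k ->
  collision (hist v i.+2) -> ~~ collision (hist v j.+2).
Proof.
have two a b : a.+2 <= b -> collision (hist v a.+2) -> 0 < ncoll (hist v b).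
  elim: b => // b IH; rewrite leq_eqVlt => /orP [/eqP <-|ab] h.
    by rewrite [ncoll _]/= -/(hist v a.+2) h.
  by rewrite (leq_trans (IH _ h)) //= leq_addl.
move=> nc ij jk ci; apply: contraTN nc => cj; rewrite -ltnNge.
elim: k jk => // k IH; rewrite leq_eqVlt => /orP [/eqP <-|jk].
  rewrite [ncoll _]/= -/(hist v j.+2) cj ltnS.
  exact: (two i j.+1).
by rewrite (leq_trans (IH _)) //= leq_addl.
Qed.

(** The first return to an old vertex, at time [t], uses up the only collision. Afterwards no fresh
    vertex can be reached, since coming back would need a backtracking step or a second collision,
    so the walk stays on its first [t] edges. Cyclic non-backtracking makes these a cycle through
    [v 0], and the walk runs around it. *)
Lemma closed_walk_period v m : 0 < m -> ncoll (hist v m.+1) <= 1 ->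
  (forall i, i < m -> v i != v i.+1) ->
  (forall i, i.+2 <= m -> v i != v i.+2) ->
  v m = v 0 -> v m.-1 != v 1 ->
  exists t, [/\ 2 < t <= m, t %| m, uniq (hist v t) &
                forall i, i <= m -> v i = v (i %% t)].
Proof.
move=> m0 nc irr nb vm cyc.
have exP : exists t, v t \in hist v t.
  by exists m; apply/mem_histP; exists 0.
case: (ex_minnP exP) => t Pt tmin.
have tm : t <= m by apply: tmin; apply/mem_histP; exists 0.
have t0 : 0 < t by case: (t) Pt.
have inj i j : i < t -> j < t -> v i = v j -> i = j.
  move=> it jt vij; case: (ltngtP i j) => // lt.
    have /tmin : v j \in hist v j by apply/mem_histP; exists i.
    by rewrite leqNgt jt.
  have /tmin : v i \in hist v i by apply/mem_histP; exists j.
  by rewrite leqNgt it.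
have ut : uniq (hist v t).
  suff : forall k, k <= t -> uniq (hist v k) by apply.
  elim=> //= k IH kt; rewrite IH ?andbT ?(ltnW kt) //.
  by apply: contraTN kt => /tmin; rewrite -leqNgt.
have neq_set a b j : v a != v b -> [set v a; v b] = [set v j.+1; v j] ->
    (v a = v j.+1 /\ v b = v j) \/ (v a = v j /\ v b = v j.+1).
  by move=> _ /eqP; rewrite eq_set2 => /orP [|] /andP [/eqP -> /eqP ->]; [left|right].
(* An old edge at time [t] would contradict injectivity before [t] or be a backtracking step. *)
have collt : collision (hist v t.+1).
  case: (t) t0 Pt tm inj => // t' _ Pt tm' inj.
  apply/andP; split=> //; apply/negP => /(@edges_histP v t'.+1).
  case=> j jt /eqP; rewrite eq_set2 => /orP [] /andP [/eqP e1 /eqP e2].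
    by have := inj t' j (ltnSn _) (ltnW jt) e2; lia.
  have E : t' = j.+1 by apply: inj => //; lia.
  by have := nb j; rewrite -E e1 eqxx => /(_ tm').
have nocoll i : t <= i -> i < m -> ~~ collision (hist v i.+2).
  case: (t) t0 collt => // t' _ ct ti im.
  by apply: (ncoll_hist1 nc _ _ ct).
have old_or_fresh i : t <= i -> i < m -> v i.+1 \in hist v i.+1 ->
    exists2 j, j < i & [set v i.+1; v i] = [set v j.+1; v j].
  move=> ti im vi; have := nocoll i ti im.
  rewrite /collision /= -/(hist v i.+1) vi /= negbK => /(@edges_histP v i.+1) [j ji e].
  by exists j.
(* A walk that reaches a fresh vertex after [t] stays on fresh vertices for ever, against
   [v m = v 0]. *)
have nofresh i : t < i -> i <= m -> v i \in hist v i.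
  move=> ti im; apply: contraT => fr.
  suff : forall k, i + k <= m -> v (i + k) \notin hist v (i + k).
    move/(_ (m - i)); rewrite subnKC // => /(_ (leqnn _)) /negP [].
    by apply/mem_histP; exists 0.
  elim=> [|k IH]; first by rewrite addn0.
  rewrite addnS => ikm; have {IH} := IH (ltnW ikm).
  have : t < i + k by rewrite ltn_addr.
  case: (i + k) ikm => // a am ta fa.
  apply/negP => /(old_or_fresh a.+1 (ltnW ta) am) [j ja /eqP].
  rewrite eq_set2 => /orP [] /andP [/eqP e1 /eqP e2].
    by case/negP: fa; apply/mem_histP; exists j.
  move: ja; rewrite ltnS leq_eqVlt => /orP [/eqP E|ja].
    by have := nb a; rewrite e1 E eqxx => /(_ am).
  by case/negP: fa; apply/mem_histP; exists j.+1.
have old i : i < m -> exists2 j, j < t & [set v i.+1; v i] = [set v j.+1; v j].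
  elim/ltn_ind: i => i IH im; case: (ltnP i t) => ti; first by exists i.
  have [j ji ->] := old_or_fresh i ti im (nofresh i.+1 ti im).
  by apply: IH => //; apply: ltn_trans im.
(* The last edge of the walk enters [v 0]. Among the first [t] edges only the first one and, if
   [v t = v 0], the last one contain [v 0]; [v m.-1 != v 1] excludes the first. *)
have vt : v t = v 0.
  move: tm; rewrite leq_eqVlt => /orP [/eqP -> //|tm].
  case: (m) m0 vm cyc old => // m' _ vm /= cyc /(_ m' (ltnSn _)) [j jt /eqP].
  rewrite vm eq_set2 => /orP [] /andP [/eqP e1 /eqP e2].
    move: jt; rewrite leq_eqVlt => /orP [/eqP <- //|jt].
    by have := inj _ _ t0 jt e1.
  have j0 : j = 0 by rewrite -(inj _ _ t0 jt e1).
  by rewrite e2 j0 eqxx in cyc.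
have vmod j : j <= t -> v j = v (j %% t).
  rewrite leq_eqVlt => /orP [/eqP ->|jt]; first by rewrite modnn.
  by rewrite modn_small.
(* From a vertex of the cycle the walk can only go on or turn back, and turning back is
   backtracking. *)
have per i : i <= m -> v i = v (i %% t).
  elim/ltn_ind: i => i IH im; case: (leqP i t) => [/vmod //|].
  case: i IH im => [|[|k]] // IH im tk; first by rewrite ltnNge t0 in tk.
  have lmod a : a %% t < t by rewrite ltn_mod.
  have [j jt /eqP] := old _ im.
  rewrite eq_set2 => /orP [] /andP [/eqP e1 /eqP e2].
    have E : k.+1 %% t = j.
      by apply: (inj _ _ (lmod k.+1) jt); rewrite -(IH k.+1 (ltnSn _) (ltnW im)).
    by rewrite e1 (vmod j.+1) // -E -[(_ %% t).+1]addn1 modnDml addn1.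
  have E : k.+1 %% t = j.+1 %% t.
    by apply: (inj _ _ (lmod _) (lmod _)); rewrite -(IH k.+1 (ltnSn _) (ltnW im)) -vmod.
  have {}E : k %% t = j.
    move/eqP: E; rewrite -[k.+1]addn1 -[j.+1]addn1 eqn_modDr => /eqP ->.
    by rewrite modn_small.
  by have := nb k im; rewrite e1 (IH k) ?E ?eqxx //; lia.
exists t; split=> //; last first.
  apply/eqP; apply: inj; rewrite ?ltn_mod //.
  by rewrite -per.
rewrite tm andbT; move: vt tm t0; case: (t) => [|[|[|]]] // vt tm _.
  by have := irr 0 tm; rewrite vt eqxx.
by have := nb 0 tm; rewrite vt eqxx.
Qed.

Definition cwalk G s := [&& nbwalk G s, ohead s == ohead (rev s) &
  ohead (behead s) != ohead (behead (rev s))].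

Definition simple_cycle G c := [&& uniq c, sorted (adj G) c &
  if c is x :: c' then adj G x (last x c') else false].

Lemma sorted_hist G v k i : sorted (adj G) (hist v k) -> i.+1 < k -> adj G (v i) (v i.+1).
Proof.
rewrite sorted_wedges => /subsetP h ik; rewrite adj_sym; apply: h.
by rewrite inE; apply/edges_histP; exists i.
Qed.

Lemma sorted_hist_le G v k l : l <= k -> sorted (adj G) (hist v k) ->
  sorted (adj G) (hist v l).
Proof.
rewrite !sorted_wedges => lk; apply: subset_trans; apply/subsetP => e.
rewrite !inE => /edges_histP [j jl ->]; apply/edges_histP; exists j => //.
exact: leq_trans lk.
Qed.

Lemma last_hist v k x : last x (hist v k.+1) = v 0.
Proof. by elim: k x => // k IH x; rewrite [LHS]/= -[RHS](IH (v k.+1)). Qed.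

Lemma rev_hist_head v k : exists s, rev (hist v k.+2) = [:: v 0, v 1 & s].
Proof.
elim: k => [|k [s IH]]; first by exists [::].
by exists (rcons s (v k.+2)); rewrite [hist _ _]/= -/(hist v k.+2) rev_cons IH.
Qed.

(** The walk is recovered from its period and a rooted oriented cycle, run around [m / t] times;
    [rev] puts the stored cycle into chronological order. *)
Lemma cwalk_structure x0 G m s : 0 < m -> size s = m.+1 -> cwalk G s -> ncoll s <= 1 ->
  exists t, [/\ 2 < t <= m, t %| m & exists c : t.-tuple T,
    simple_cycle G c && (s == hist (fun i => nth x0 (rev c) (i %% t)) m.+1)].
Proof.
move=> m0 sz; rewrite -(hist_nth x0 s) sz; set v := nth x0 _.
case/and3P => /andP [srt nbk] cl cyc nc.
have [||||t [tm dvd ut per]] := closed_walk_period m0 nc.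
- by move=> i im; apply: (adj_neq (sorted_hist srt _)).
- move=> i im; rewrite -nonback_rev in nbk.
  move/(nonbackP x0): nbk => /(_ i); rewrite size_rev size_hist ltnS im.
  by rewrite !nth_rev_hist ?ltnS //; [apply|lia].
- move: cl; case: (m) m0 => // k _; have [r ->] := rev_hist_head v k.
  by rewrite /= => /eqP [->].
- move: cyc; case: (m) m0 => // k _; have [r ->] := rev_hist_head v k.
  by rewrite /=; apply: contraNneq => ->.
exists t; split=> //; exists (tcast (size_hist v t) (in_tuple (hist v t))).
have t0 : 0 < t by case/andP: tm => /ltnW /ltnW.
have sub t' : hist v t = t' -> simple_cycle G t' && (hist v m.+1 ==
   hist (fun i => nth x0 (rev t') (i %% t)) m.+1).
  move=> <-; apply/andP; split; last first.
    apply/eqP/eq_hist => i; rewrite ltnS => /per ->.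
    by rewrite nth_rev_hist ?ltn_mod // modn_mod.
  rewrite /simple_cycle ut (sorted_hist_le _ srt) /=; last by case/andP: tm; lia.
  have := per t; case/andP: tm => t3 tm /(_ tm); rewrite modnn.
  case: (t) t0 tm => // t1 _ tm vt /=.
  have -> : last (v t1) (hist v t1) = v 0 by rewrite -[RHS](last_hist v t1 (v t1)).
  by rewrite -vt; apply: (sorted_hist srt).
by apply: sub; rewrite val_tcast.
Qed.

End ClosedWalks.

(** * Expected numbers of simple cycles and of closed walks *)

Section CountClosedWalks.
Variables (T : finType) (d : nat).
Local Notation n := #|T|.
Local Notation q := d.-1.
Local Notation N := #|[set G : sgraph T | regular d G]|.
Implicit Types (G : sgraph T) (u x y : T) (s c : seq T).

Definition cycle_count t :=
  \sum_(G : sgraph T | regular d G) \sum_(c : t.-tuple T) simple_cycle G c.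

Definition cwalk_count m :=
  \sum_(G : sgraph T | regular d G) \sum_(s : m.+1.-tuple T) cwalk G s.

Lemma edeg_gt0 (H : {set {set T}}) x y : [set x; y] \in H -> 0 < edeg H x.
Proof. by move=> xy; apply/card_gt0P; exists y; rewrite inE. Qed.

Lemma edeg_head x y s : 0 < edeg (wedges [:: x, y & s]) x.
Proof. by apply: (@edeg_gt0 _ _ y); rewrite wedges_cons2 !inE eqxx. Qed.

Lemma edeg_last x y s : 0 < edeg (wedges [:: x, y & s]) (last y s).
Proof.
suff [z zP] : exists z, [set last y s; z] \in wedges [:: x, y & s].
  exact: edeg_gt0 zP.
elim: s x y => [|z s IH] x y /=.
  by exists x; rewrite wedges_cons2 setUC !inE eqxx.
by have [w wP] := IH y z; exists w; rewrite wedges_cons2 in_setU wP orbT.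
Qed.

Lemma closing_edge_new x y z s : uniq [:: x, y, z & s] ->
  [set x; last z s] \notin wedges [:: x, y, z & s].
Proof.
move=> /[dup] uq; rewrite cons_uniq => /andP [xn]; rewrite cons_uniq => /andP [yn _].
rewrite wedges_cons2 in_setU1 negb_or; apply/andP; split.
  rewrite eq_set2 negb_or eqxx /=; apply/andP; split.
    by apply: contraNneq yn => <-; exact: mem_last.
  by apply: contraNN xn => /andP [/eqP -> _]; rewrite inE eqxx.
apply: contra xn; rewrite inE => h; apply: (mem_walk_edges h).
by rewrite !inE eqxx.
Qed.

Lemma uniq_nonback s : uniq s -> nonback s.
Proof.
elim: s => [|x s IH] //= /andP [xs us]; rewrite IH // andbT.
case: s xs {IH us} => [|y [|z s]] //=; apply: contraNneq => -[->].
by rewrite !inE eqxx orbT.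
Qed.

Lemma regs_sum s (b : sgraph T -> bool) :
  \sum_(G : sgraph T | regular d G) (sorted (adj G) s && b G) =
  #|[set G in regs d (wedges s) | b G]|.
Proof.
rewrite -sum1dep_card [RHS]big_mkcond [LHS]big_mkcond /=; apply: eq_bigr => G _.
by rewrite mem_regs; case: regular => //=; case: sorted => //=; case: (b G).
Qed.

(** A cycle is a path with a closing edge. The paths are among the walks counted by [coll_count0],
    and each end of the closing edge already uses one of its [d] edges, so [switching] yields
    [q * q] rather than [d * d]. This keeps the leading constant equal to one. *)
Lemma simple_cycle_count t : 2 < t ->
  cycle_count t * (n * d - 2 * t - 2 * (d * d.+1)) <= N * (n * d * q ^ t).
Proof.
case: t => [|[|[|t]]] // _.
rewrite /cycle_count exchange_big big_distrl /=.
have -> : N * (n * d * q ^ t.+3) = coll_count T d 0 t.+3 * (q * q).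
  by rewrite coll_count0 !expnS; lia.
rewrite /coll_count big_distrl /=; apply: leq_sum => -[c /= /eqP szc] _.
case: c szc => [|x [|y [|z c]]] // szc.
rewrite /simple_cycle; case: (boolP (uniq _)) => [uq|_]; last by rewrite /= big1.
rewrite (uniq_nonback uq) andTb mul1n (regs_sum [:: x, y, z & c] (fun G => adj G x (last z c))).
have -> : [set G in regs d (wedges [:: x, y, z & c]) | adj G x (last z c)] =
  regs d ([set x; last z c] |: wedges [:: x, y, z & c]).
  by apply/setP => G; rewrite !inE subUset sub1set -andbA; congr andb; rewrite andbC.
have := switching d (closing_edge_new uq).
have := card_wedges [:: x, y, z & c]; rewrite szc => cw.
move=> sw; apply: leq_trans (leq_trans sw _).
  by rewrite leq_mul2l; apply/orP; right; move: cw => /=; lia.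
rewrite leq_mul2l; apply/orP; right.
have h1 := edeg_head x y (z :: c); have h2 := edeg_last x y (z :: c).
by apply: leq_mul; rewrite -subn1 leq_sub2l.
Qed.

(** Walks with two collisions are counted apart; every other walk is the image under [ext] of a
    cycle whose length divides [m]. *)
Lemma cwalk_count_le m : 0 < m -> cwalk_count m <=
  coll_count T d 2 m.+1 + \sum_(t < m.+1 | (2 < t) && (t %| m)) cycle_count t.
Proof.
move=> m0; rewrite /cwalk_count /cycle_count /coll_count.
have -> : \sum_(s : m.+1.-tuple T) (nonback s && (1 < ncoll s)) * #|regs d (wedges s)| =
  \sum_(G : sgraph T | regular d G) \sum_(s : m.+1.-tuple T)
     (sorted (adj G) s && (nonback s && (1 < ncoll s))).
  rewrite exchange_big; apply: eq_bigr => s _.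
  rewrite regs_sum; case: (_ && _); rewrite ?mul1n ?mul0n; apply/esym.
    by apply: eq_card => G; rewrite inE andbT.
  by apply: eq_card0 => G; rewrite inE andbF.
rewrite [X in _ <= _ + X]exchange_big -big_split /=; apply: leq_sum => G reg.
have [n0|/card_gt0P [x0 _]] := posnP n.
  rewrite big1 // => -[s /= /eqP sz] _.
  by case: s sz => [|x s] // _; have := card0_eq n0 x; rewrite inE.
pose ext t (c : seq T) := hist (fun i => nth x0 (rev c) (i %% t)) m.+1.
apply: (@leq_trans (\sum_(s : m.+1.-tuple T)
   (sorted (adj G) s && (nonback s && (1 < ncoll s)) +
    \sum_(t < m.+1 | (2 < t) && (t %| m)) \sum_(c : t.-tuple T)
       simple_cycle G c * (ext t c == s)))).
  apply: leq_sum => s _; case: (boolP (cwalk G s)) => // cw.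
  have [nc|nc] := leqP 2 (ncoll s).
    by case/and3P: cw => /andP [-> ->] _ _; rewrite leq_addr.
  have [|t [/andP [t2 tm] dvd [c /andP [sc /eqP sE]]]] := @cwalk_structure _ x0 G m s m0 _ cw nc.
    by rewrite size_tuple.
  apply: leq_trans (leq_addl _ _).
  have tm' : t < m.+1 by [].
  rewrite (bigD1 (Ordinal tm')) /= ?t2 ?dvd // (bigD1 c) //= sc /ext -sE eqxx.
  by rewrite -addnA leq_addr.
rewrite big_split leq_add2l /= exchange_big /=; apply: leq_sum => t _.
rewrite exchange_big /=; apply: leq_sum => c _.
rewrite -big_distrr /= -[leqRHS]muln1 leq_mul2l; apply/orP; right.
rewrite (@leq_trans (\sum_(s : m.+1.-tuple T | s == tcast (size_hist _ _) (in_tuple (ext t c))) 1)) //.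
  rewrite [leqRHS]big_mkcond /=; apply: leq_sum => s _.
  case: eqP => // e; case: eqP => // -[]; apply: val_inj.
  by rewrite /= val_tcast.
by rewrite big_pred1_eq.
Qed.

Lemma sum_expn_le k : 1 < q -> \sum_(t < k.+1) q ^ t <= 2 * q ^ k.
Proof.
move=> q1; elim: k => [|k IH]; first by rewrite big_ord1.
rewrite big_ord_recr /= expnS; move: IH; set S := \sum_(_ < _) _.
by have := leq_pmul2r (m := q ^ k) (n1 := 2) (n2 := q); rewrite expn_gt0 q1; lia.
Qed.

(** Only [t = 2 * k] gives the leading term: proper divisors of [2 * k] are at most [k], and the
    powers up to [q ^ k] sum to at most [2 * q ^ k]. *)
Lemma cycle_counts_le k : 1 < q -> 0 < k ->
  (\sum_(t < (2 * k).+1 | (2 < t) && (t %| 2 * k)) cycle_count t) *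
    (n * d - 4 * k - 2 * (d * d.+1)) <=
  N * (n * d) * (q ^ (2 * k) + 2 * q ^ k).
Proof.
move=> q1 k0; rewrite big_distrl /=.
apply: (@leq_trans (\sum_(t < (2 * k).+1 | (2 < t) && (t %| 2 * k))
    N * (n * d) * q ^ t)).
  apply: leq_sum => t /andP [t2 dvd].
  rewrite -mulnA; apply: leq_trans (simple_cycle_count t2).
  rewrite leq_mul2l; apply/orP; right; apply/leq_sub2r/leq_sub2l.
  by rewrite -[4]/(2 * 2) -mulnA leq_mul2l /= -ltnS ltn_ord.
rewrite -big_distrr leq_mul2l /=; apply/orP; right.
rewrite -(big_mkord (fun t => (2 < t) && (t %| 2 * k)) (fun t => q ^ t)).
rewrite big_mkcond big_nat_recr //= addnC.
apply: leq_add; first by case: ifP.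
rewrite (@big_cat_nat _ _ _ k.+1) //=; last by lia.
rewrite [X in _ + X]big_nat_cond [X in _ + X]big1 ?addn0; last first.
  move=> t /andP [/andP [kt tk] _]; case: ifP => // /andP [_ /dvdnP [a E]].
  by case: a E => [|[|a]]; lia.
rewrite (leq_trans _ (sum_expn_le k q1)) // big_mkord.
by apply: leq_sum => t _; case: ifP.
Qed.

End CountClosedWalks.

(** * Pairs of walks with the same ends *)

Section SecondMoment.
Variables (T : finType) (d : nat).
Local Notation n := #|T|.
Local Notation q := d.-1.
Local Notation N := #|[set G : sgraph T | regular d G]|.
Implicit Types (G : sgraph T) (u x y : T) (s t : seq T) (b c : bool).

Definition same_second s t := ohead (behead s) == ohead (behead t).

(** For walks with the same ends, the flags record whether they also share their edge at the head
    ([b]) and at the other end ([c]). *)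
Definition walk_pair G b c s t :=
  [&& nbwalk G s, nbwalk G t, ohead s == ohead t, ohead (rev s) == ohead (rev t),
      same_second s t == b & same_second (rev s) (rev t) == c].

Definition pair_count G b c k :=
  \sum_(s : k.-tuple T) \sum_(t : k.-tuple T) walk_pair G b c s t.

Lemma walk_pair_cons G c x y u w s t :
  walk_pair G true c (x :: u :: s) (y :: w :: t) ->
  0 < size s -> 0 < size t ->
  [/\ x = y, adj G x u, Some x != ohead s, Some x != ohead t &
      walk_pair G (same_second (u :: s) (w :: t)) c (u :: s) (w :: t)].
Proof.
case: s => // s0 s; case: t => // t0 t; rewrite /walk_pair !nbwalk_cons2.
have rv (a b1 b2 : T) r : exists2 r', rev [:: b1, b2 & r] = r' &
     ohead (rev [:: a, b1, b2 & r]) = ohead r'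
     /\ ohead (behead (rev [:: a, b1, b2 & r])) = ohead (behead r').
  eexists; first by [].
  rewrite (rev_cons a); have : 1 < size (rev [:: b1, b2 & r]) by rewrite size_rev.
  by case: (rev _) => [|? [|]].
have [r1 <- [e1 e2]] := rv x u s0 s; have [r2 <- [e3 e4]] := rv y w t0 t.
rewrite /same_second e1 e2 e3 e4 !eqxx => {rv e1 e2 e3 e4}.
case/and5P => /and3P [xu h1 ->] /and3P [_ h2 ->] /eqP [xy] -> /andP [/eqP uw ->] _ _.
have /eqP [uw'] : Some u == Some w by [].
rewrite /= -uw' xy !eqxx -{1}xy; split=> //; rewrite -?xy //.
  by apply: contraNneq h1 => -[->].
by apply: contraNneq h2 => -[<-]; rewrite xy.
Qed.

(** A common head edge is stripped. If the shorter walks diverge at once, the removed vertex avoids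
    two different neighbours, leaving [q.-1] choices; otherwise it avoids one, leaving [q]. *)
Lemma pair_count_peel G c k : regular d G -> 1 < k ->
  pair_count G true c k.+1 <=
  q.-1 * pair_count G false c k + q * pair_count G true c k.
Proof.
move=> reg k1; rewrite /pair_count.
rewrite (@sum_tuple_cons _ _ (fun s => \sum_(t : k.+1.-tuple T) walk_pair G true c s t)).
rewrite !big_distrr -big_split /=; apply: leq_sum => s _.
rewrite exchange_big /= (@sum_tuple_cons _ _ (fun t => \sum_u walk_pair G true c (u :: s) t)).
rewrite !big_distrr -big_split /=; apply: leq_sum => t _.
have := size_tuple s; have := size_tuple t.
case: (tval s) => [|a [|b s']]; try by move=> /= _ E; rewrite -E in k1.
case: (tval t) => [|a' [|b' t']]; try by move=> /= E _; rewrite -E in k1.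
move=> _ _.
have bnd x y : walk_pair G true c [:: y, a, b & s'] [:: x, a', b' & t'] <=
  (x == y) * (y \in [set z | adj G a z] :\ b :\ b') *
   walk_pair G (same_second [:: a, b & s'] [:: a', b' & t']) c [:: a, b & s'] [:: a', b' & t'].
  case: (boolP (walk_pair G true _ _ _)) => // /walk_pair_cons [] // -> ya yb yb' ->.
  rewrite !inE eqxx /= adj_sym ya andbT muln1.
  rewrite -[_ == b]/(Some x == Some b) -[_ == b']/(Some x == Some b').
  by rewrite yb yb'.
apply: (@leq_trans (#|[set z | adj G a z] :\ b :\ b'| *
   walk_pair G (same_second [:: a, b & s'] [:: a', b' & t']) c [:: a, b & s'] [:: a', b' & t'])).
  rewrite -sum1_card big_distrl [leqRHS]big_mkcond /=; apply: leq_sum => x _.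
  apply: leq_trans; first by apply: leq_sum => y _; exact: bnd.
  rewrite (bigD1 x) //= big1 ?addn0 => [|y /negbTE yx]; last by rewrite eq_sym yx.
  by rewrite eqxx mul1n; case: ifP => h; rewrite ?mul1n.
have [wp|] := boolP (walk_pair G (same_second _ _) _ _ _); last by rewrite muln0.
have : same_second [:: a, b & s'] [:: a', b' & t'] = (b == b') by [].
have [E1 [E2 E3]] : a = a' /\ adj G a b /\ adj G a' b'.
  case/and5P: wp => /andP [w1 _] /andP [w2 _] /eqP [aa] _ _.
  by move: w1 w2; rewrite /= => /andP [-> _] /andP [-> _].
have c1 : #|[set z | adj G a z] :\ b| = q.
  by rewrite -(card_nbr a reg) (cardsD1 b [set z | _]) inE E2.
rewrite muln1; move: wp; case: eqVneq => [<-|bb'] wp E; rewrite E in wp; rewrite wp.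
  by rewrite muln1 (leq_trans _ (leq_addl _ _)) // -c1 subset_leq_card // subD1set.
rewrite muln1 (leq_trans _ (leq_addr _ _)) // -c1 (cardsD1 b' (_ :\ b)) !inE.
by rewrite eq_sym bb' E1 E3.
Qed.

Lemma pair_count_sym G k : pair_count G false true k = pair_count G true false k.
Proof.
have rinv : bijective (fun s : k.-tuple T => [tuple of rev s]).
  by exists (fun s : k.-tuple T => [tuple of rev s]) => s; apply: val_inj; rewrite /= revK.
rewrite /pair_count [LHS](reindex _ (onW_bij _ rinv)) /=; apply: eq_bigr => s _.
rewrite [LHS](reindex _ (onW_bij _ rinv)) /=; apply: eq_bigr => t _ /=.
by rewrite /walk_pair !nbwalk_rev !revK; congr nat_of_bool; do !bool_congr.
Qed.

Lemma sum_bool_card (I : finType) (P : pred I) :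
  \sum_(i : I) (P i : nat) = #|[set i | P i]|.
Proof. by rewrite -sum1dep_card [RHS]big_mkcond; apply: eq_bigr => i _; case: (P i). Qed.

Lemma nbwalk_join G s x y z t : nbwalk G (s ++ [:: x; y]) ->
  nbwalk G [:: y, z & t] -> z != x -> nbwalk G (s ++ [:: x, y, z & t]).
Proof.
move=> + h zx; elim: s => [|a [|b [|c s]] IH].
- by rewrite !cat0s nbwalk_cons2 h zx !andbT => /andP [/andP [-> _] _].
- by move: IH; rewrite !cat_cons ?cat0s !nbwalk_cons2 => IH /and3P [-> -> /IH].
- by move: IH; rewrite !cat_cons ?cat0s !nbwalk_cons2 => IH /and3P [-> -> /IH].
- by move: IH; rewrite !cat_cons ?cat0s !nbwalk_cons2 => IH /and3P [-> -> /IH].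
Qed.

(** The closed walk follows [s] and returns along [t]. Divergence of the two walks forbids
    backtracking at the junction (flag [c]) and at the base point (flag [b]). *)
Lemma walk_pair_cwalk G s t : 1 < size s -> 1 < size t ->
  walk_pair G false false s t -> cwalk G (s ++ behead (rev t)).
Proof.
have hd1 (r r' : seq T) : 1 < size r ->
    ohead (r ++ r') = ohead r /\ ohead (behead (r ++ r')) = ohead (behead r).
  by case: r => [|? [|]].
move=> s1 t1 /and5P [ws wt hd ls /andP [sec1 sec2]].
have [ta tb] := hd1 t (rev (take (size s).-1 s)) t1.
have [sa sb] := hd1 s (behead (rev t)) s1.
have revE : rev (s ++ behead (rev t)) = t ++ rev (take (size s).-1 s).
  rewrite -[t in RHS]revK -rev_cat; congr rev.
  case/lastP: s s1 ls {ws hd sec1 sec2 ta tb sa sb} => // s y _.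
  rewrite rev_rcons size_rcons /= -cats1 take_size_cat //.
  case: (rev t) => [|y' r] //= /eqP [<-]; by rewrite -catA.
rewrite /cwalk revE sa sb ta tb hd /= andbC /=.
apply/andP; split; first by rewrite -/(same_second s t) (eqP sec1).
move: wt ls sec2 {revE ta tb sa sb hd sec1}; rewrite -(nbwalk_rev _ t).
have : 1 < size (rev t) by rewrite size_rev.
case: (rev t) => [|y [|w r]] // _; case/lastP: s s1 ws => [|s y'] //.
case/lastP: s => [|s w'] // _ ws wr.
rewrite !rev_rcons /= => /eqP [E]; subst y'; rewrite /same_second /= => wne.
have -> : rcons (rcons s w') y ++ w :: r = s ++ [:: w', y, w & r].
  by rewrite -!cats1 -!catA.
apply: nbwalk_join => //; first by move: ws; rewrite -!cats1 -!catA.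
by move: wne; rewrite eqbF_neg; apply: contraNneq => ->.
Qed.

(** Joining is injective: the place of the cut is known, and the vertex dropped from [rev t] is the
    last vertex of [s]. *)
Lemma pair_count_cwalk G l : pair_count G false false l.+2 <=
  \sum_(s : (2 * l.+1).+1.-tuple T) cwalk G s.
Proof.
have szc (p : l.+2.-tuple T * l.+2.-tuple T) :
    size (p.1 ++ behead (rev p.2)) == (2 * l.+1).+1.
  by rewrite size_cat size_behead size_rev !size_tuple; apply/eqP; lia.
rewrite /pair_count pair_big /= sum_bool_card sum_bool_card.
pose f p := Tuple (szc p).
set A := [set _ | _]; rewrite -(@card_in_imset _ _ f A).
  apply/subset_leq_card/subsetP => _ /imsetP [[s t] /[swap] ->]; rewrite !inE /=.
  by apply: walk_pair_cwalk; rewrite size_tuple.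
move=> [s t] [s' t']; rewrite !inE /= => /and5P [_ _ _ ls _] /and5P [_ _ _ ls' _].
move/(congr1 val) => /= /eqP; rewrite eqseq_cat ?size_tuple // => /andP [/eqP es /eqP et].
have {}es : s = s' by apply: val_inj.
subst s'; congr (_, _); apply: val_inj; apply: (can_inj revK).
move: ls'; rewrite (eqP ls) => /eqP; move: et.
have := size_tuple t; have := size_tuple t'; rewrite -(size_rev t) -(size_rev t').
by case: (rev t) => // a r; case: (rev t') => // a' r' _ _ /= -> [->].
Qed.

Definition walk_count G x y k :=
  \sum_(s : k.-tuple T) [&& nbwalk G s, ohead s == Some x & ohead (rev s) == Some y].

Lemma sum_ends k (F : k.+1.-tuple T -> nat) :
  \sum_x \sum_y \sum_(s : k.+1.-tuple T)
    F s * ((ohead s == Some x) && (ohead (rev s) == Some y)) = \sum_(s : k.+1.-tuple T) F s.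
Proof.
rewrite pair_big /= exchange_big /=; apply: eq_bigr => s _; rewrite -big_distrr /=.
suff -> : \sum_(p : T * T) ((ohead s == Some p.1) && (ohead (rev s) == Some p.2)) = 1.
  by rewrite muln1.
have sz : size (rev s) = k.+1 by rewrite size_rev size_tuple.
case: (rev s) sz => // y r _; have := size_tuple s.
case: (tval s) => // x r' _; rewrite (bigD1 (x, y)) //= !eqxx big1 // => -[x' y'].
move=> ne; apply/eqP; rewrite eqb0; apply: contra ne => /andP [/eqP [->] /eqP [->]].
exact: eqxx.
Qed.

Lemma sum_walk_count G l : regular d G ->
  \sum_x \sum_y walk_count G x y l.+2 = n * d * q ^ l.
Proof.
move=> reg; rewrite -(sum_nbwalk l reg) -(sum_ends (fun s : l.+2.-tuple T => nbwalk G s : nat)).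
apply: eq_bigr => x _; apply: eq_bigr => y _; apply: eq_bigr => s _.
by case: nbwalk; rewrite ?mul1n.
Qed.

Lemma sum_walk_count_sq G l :
  \sum_x \sum_y walk_count G x y l.+2 ^ 2 =
  pair_count G true true l.+2 + pair_count G true false l.+2 +
  pair_count G false true l.+2 + pair_count G false false l.+2.
Proof.
rewrite /pair_count -!big_split /=.
rewrite -[RHS]sum_ends; apply: eq_bigr => x _; apply: eq_bigr => y _.
rewrite -mulnn {1}/walk_count big_distrl /=; apply: eq_bigr => s _.
rewrite -!big_split /= big_distrl big_distrr /=; apply: eq_bigr => t _.
rewrite /walk_pair; case: (nbwalk G s) => //; case: (nbwalk G t); rewrite ?muln0 //=.
case: (ohead s =P Some x) => [->|_]; last by rewrite muln0.
case: (ohead (rev s) =P Some y) => [->|_]; last by rewrite muln0.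
rewrite muln1 mul1n !(eq_sym (Some x)) !(eq_sym (Some y)).
by case: eqP => //= _; case: eqP => //= _; do 2!case: same_second.
Qed.

Definition zero_count G k := #|[set p : T * T | walk_count G p.1 p.2 k == 0]|.

(* The variance of the walk counts, with denominators cleared. *)
Lemma zero_count_variance G l : regular d G ->
  zero_count G l.+2 * (d * q ^ l) ^ 2 + n ^ 2 * (d * q ^ l) ^ 2 <=
  n ^ 2 * \sum_x \sum_y walk_count G x y l.+2 ^ 2.
Proof.
move=> reg; set m := d * q ^ l.
(* If [X] is the walk count of a pair, its mean over pairs is [m / n]. The square of [n * X - m] is
   nonnegative, and equals [m ^ 2] when [X = 0]. *)
have : \sum_x \sum_y ((walk_count G x y l.+2 == 0) * m ^ 2 +
         2 * (n * walk_count G x y l.+2 * m)) <=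
       \sum_x \sum_y ((n * walk_count G x y l.+2) ^ 2 + m ^ 2).
  apply: leq_sum => x _; apply: leq_sum => y _.
  by case: eqP => [->|_]; rewrite ?muln0 ?mul1n ?mul0n ?add0n ?addn0 ?leqnn // nat_Cauchy.
under eq_bigr do rewrite big_split /= -big_distrl -!big_distrr -big_distrl -big_distrr /=.
rewrite big_split /= -big_distrl -!big_distrr -big_distrl -big_distrr /=.
rewrite sum_walk_count // pair_big /= sum_bool_card.
under [X in _ <= X]eq_bigr do under eq_bigr do rewrite expnMn.
under [X in _ <= X]eq_bigr do rewrite big_split /= -big_distrr /= sum_nat_const.
rewrite big_split /= -big_distrr /= sum_nat_const.
rewrite -/(zero_count G l.+2) (_ : #|pred_of_simpl _| = n) //.
have -> : n * d * q ^ l = n * m by rewrite mulnA.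
have -> : n * (n * m ^ 2) = n ^ 2 * m ^ 2 by ring.
have -> : 2 * (n * (n * m) * m) = n ^ 2 * m ^ 2 + n ^ 2 * m ^ 2 by ring.
by rewrite addnA leq_add2r.
Qed.

End SecondMoment.

(** * Expected number of pairs joined by no non-backtracking walk of a given length *)

Section ExpectedZeroCount.
Variables (T : finType) (d : nat).
Local Notation n := #|T|.
Local Notation q := d.-1.
Local Notation N := #|[set G : sgraph T | regular d G]|.
Hypothesis d3 : 2 < d.

Lemma degree_pred : exists r, q = r.+1.
Proof. by exists q.-1; lia. Qed.

(** [walk_err l / n] is the relative error in the count of closed walks of length [2 * l.+1]: the
    first summand comes from two collisions, the second from the denominator of the cycle count. *)
Definition walk_err l := 4 * d ^ 3 * (2 * l + 3) ^ 4 + (8 * l.+1 + 4 * (d * d.+1)).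

Lemma cwalk_count_bound l : 8 * l.+1 + 4 * (d * d.+1) <= n ->
  n * cwalk_count T d (2 * l.+1) <=
  N * ((n + walk_err l) * q ^ (2 * l.+1) + 4 * n * q ^ l.+1).
Proof.
move=> big.
have n0 : 0 < n by lia.
have q0 : 0 < q by have [r ->] := degree_pred.
have nd : n <= n * d by rewrite leq_pmulr //; lia.
have c2 : n * coll_count T d 2 (2 * l.+1).+1 <=
    N * (4 * d ^ 3 * (2 * l + 3) ^ 4 * q ^ (2 * l.+1)).
  have -> : (2 * l.+1).+1 = (2 * l).+1.+2 by lia.
  have := @coll_count2 T d (2 * l).+1; set B := coll_count _ _ _ _ => h.
  have {}h : n ^ 2 * B <= (2 * d) ^ 2 * (2 * l).+3 ^ 4 * (N * (n * d * q ^ (2 * l).+1)).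
    by apply: h; lia.
  rewrite -(leq_pmul2l n0) mulnA; apply: (leq_trans h).
  have -> : 2 * l + 3 = (2 * l).+3 by lia.
  have -> : q ^ (2 * l.+1) = q * q ^ (2 * l).+1 by rewrite -expnS; congr (_ ^ _); lia.
  have -> : n * (N * (4 * d ^ 3 * (2 * l).+3 ^ 4 * (q * q ^ (2 * l).+1))) =
    q * ((2 * d) ^ 2 * (2 * l).+3 ^ 4 * (N * (n * d * q ^ (2 * l).+1))) by ring.
  by rewrite leq_pmull.
have cc : n * (\sum_(t < (2 * l.+1).+1 | (2 < t) && (t %| 2 * l.+1)) cycle_count T d t) <=
    N * ((n + (8 * l.+1 + 4 * (d * d.+1))) * (q ^ (2 * l.+1) + 2 * q ^ l.+1)).
  have q1 : 1 < q by lia.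
  have := @cycle_counts_le T d l.+1 q1 isT.
  set S := \sum_(_ < _ | _) _; set X := _ ^ _ + _.
  set K := _ - _ => h.
  have K0 : 0 < K by rewrite /K; lia.
  (* [K] is [n * d - c] with [2 * c <= n]; dividing [n * d] by it costs at most a factor
     [1 + 2 * c / n]. *)
  have KE : n * (n * d) <= (n + (8 * l.+1 + 4 * (d * d.+1))) * K.
    have : K + (4 * l.+1 + 2 * (d * d.+1)) = n * d by rewrite /K; lia.
    move: big; have : n * 3 <= n * d by rewrite leq_mul2l d3 orbT.
    have -> : 8 * l.+1 + 4 * (d * d.+1) = 2 * (4 * l.+1 + 2 * (d * d.+1)) by lia.
    by move: (4 * _ + _) => c; move: (n * d) => m; clearbody K; nia.
  rewrite -(leq_pmul2r K0) -mulnA.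
  apply: (@leq_trans (n * (N * (n * d) * X))); first by rewrite leq_mul2l h orbT.
  have -> : n * (N * (n * d) * X) = N * X * (n * (n * d)) by ring.
  have -> : N * ((n + (8 * l.+1 + 4 * (d * d.+1))) * X) * K =
     N * X * ((n + (8 * l.+1 + 4 * (d * d.+1))) * K) by ring.
  by rewrite leq_mul2l KE orbT.
apply: (@leq_trans (n * (coll_count T d 2 (2 * l.+1).+1 +
  \sum_(t < (2 * l.+1).+1 | (2 < t) && (t %| 2 * l.+1)) cycle_count T d t))).
  by rewrite leq_mul2l cwalk_count_le // orbT.
rewrite mulnDr; apply: leq_trans (leq_add c2 cc) _.
rewrite -mulnDr leq_mul2l; apply/orP; right; rewrite /walk_err.
have h : (8 * l.+1 + 4 * (d * d.+1)) * (2 * q ^ l.+1) <= n * (2 * q ^ l.+1).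
  by rewrite leq_mul2r big orbT.
move: h; set c := 8 * l.+1 + _; set e := 4 * _ * _.
move: (q ^ _) (q ^ l.+1) => x y; nia.
Qed.

Definition pair_total b c l := \sum_(G : sgraph T | regular d G) pair_count G b c l.+2.

Lemma pair_total_peel c l :
  pair_total true c l.+1 <= q.-1 * pair_total false c l + q * pair_total true c l.
Proof.
rewrite /pair_total !big_distrr -big_split /=; apply: leq_sum => G reg.
exact: pair_count_peel.
Qed.

Lemma pair_total_sym l : pair_total false true l = pair_total true false l.
Proof. by apply: eq_bigr => G _; rewrite pair_count_sym. Qed.

Lemma pair_total_cwalk l : pair_total false false l <= cwalk_count T d (2 * l.+1).
Proof. by apply: leq_sum => G _; apply: pair_count_cwalk. Qed.

Lemma tuple2_ends (s t : 2.-tuple T) :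
  ohead s = ohead t -> ohead (rev s) = ohead (rev t) -> s = t.
Proof.
case: s => [[|a [|b []]] //= ps]; case: t => [[|a' [|b' []]] //= pt].
by move=> [E] [E']; apply: val_inj; rewrite /= E E'.
Qed.

Lemma pair_total0 : pair_total true false 0 = 0.
Proof.
apply: big1 => G _; apply: big1 => s _; apply: big1 => t _.
apply/eqP; rewrite eqb0; apply/negP => /and5P [_ _ /eqP h /eqP r].
by rewrite (tuple2_ends h r) /same_second !eqxx.
Qed.

Lemma pair_total_base : pair_total true true 0 <= N * (n * d).
Proof.
rewrite -sum_nat_cond_const; apply: leq_sum => G reg.
rewrite -[leqRHS]muln1 -(sum_nbwalk 0 reg); apply: leq_sum => s _.
rewrite (bigD1 s) //= big1 ?addn0 => [|t ts].
  by rewrite /walk_pair; case: nbwalk => //; apply: leq_b1.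
apply/eqP; rewrite eqb0; apply/negP => /and5P [_ _ /eqP h /eqP r] _.
by move: ts; rewrite (tuple2_ends h r) eqxx.
Qed.

Lemma pair_total_ff l : 8 * l.+1 + 4 * (d * d.+1) <= n ->
  n * pair_total false false l <=
  N * ((n + walk_err l) * q ^ (2 * l.+1) + 4 * n * q ^ l.+1).
Proof.
move=> big; apply: leq_trans (cwalk_count_bound big).
by rewrite leq_mul2l pair_total_cwalk orbT.
Qed.

Lemma walk_errS l : walk_err l <= walk_err l.+1.
Proof.
rewrite /walk_err leq_add //; last lia.
by rewrite leq_mul2l leq_exp2r // (_ : _ <= _) ?orbT //; lia.
Qed.

Lemma pair_total_tf l : 8 * l.+1 + 4 * (d * d.+1) <= n ->
  n * pair_total true false l <=
  N * ((n + walk_err l) * q ^ (2 * l).+1 + 4 * n * l.+1 * q ^ l.+1).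
Proof.
elim: l => [|l IH] big; first by rewrite pair_total0 muln0.
have bigl : 8 * l.+1 + 4 * (d * d.+1) <= n by lia.
have h := pair_total_peel false l; have h1 := pair_total_ff bigl.
have {IH} h2 := IH bigl.
apply: (@leq_trans (q.-1 * (n * pair_total false false l) + q * (n * pair_total true false l))).
  by rewrite -!(mulnCA n) -mulnDr leq_mul2l h orbT.
apply: (leq_trans (leq_add (leq_mul (leqnn _) h1) (leq_mul (leqnn _) h2))).
rewrite -!(mulnCA N) -mulnDr leq_mul2l; apply/orP; right.
apply: (@leq_trans ((n + walk_err l) * q ^ (2 * l.+1).+1 + 4 * n * l.+2 * q ^ l.+2)); last first.
  by rewrite leq_add2r leq_mul2r leq_add2l walk_errS orbT.
have [r ->] := degree_pred.
have -> : 2 * l.+1 = (2 * l).+2 by lia.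
rewrite !expnS /=; set X := r.+1 ^ (2 * l); set Y := r.+1 ^ l; set A := n + _.
(* With [r = q - 1] the leading powers add up without loss: [(q - 1) * q ^ (2 * l + 2) + q * q ^ (2
   * l + 1) = q ^ (2 * l + 3)]. *)
have -> : A * (r.+1 * (r.+1 * (r.+1 * X))) + 4 * n * l.+2 * (r.+1 * (r.+1 * Y)) =
  r * (A * (r.+1 * (r.+1 * X)) + 4 * n * (r.+1 * Y)) +
  r.+1 * (A * (r.+1 * X) + 4 * n * l.+1 * (r.+1 * Y)) + 4 * n * (r.+1 * Y) by ring.
exact: leq_addr.
Qed.

(** The last term stems from the base case, where both walks are the same single step; each common
    edge put back multiplies it by [q]. *)
Lemma pair_total_tt l : 8 * l.+1 + 4 * (d * d.+1) <= n ->
  n * pair_total true true l <=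
  N * ((n + walk_err l) * q ^ (2 * l) + 4 * n * l.+1 ^ 2 * q ^ l.+1 + n * (n * d) * q ^ l).
Proof.
elim: l => [|l IH] big.
  apply: (@leq_trans (N * (n * (n * d)))).
    by rewrite mulnCA leq_mul2l pair_total_base orbT.
  rewrite leq_mul2l; apply/orP; right; apply: leq_trans (leq_addl _ _).
  by rewrite expn0 [leqRHS]muln1.
have bigl : 8 * l.+1 + 4 * (d * d.+1) <= n by lia.
have h := pair_total_peel true l; rewrite pair_total_sym in h.
have h1 := pair_total_tf bigl; have {IH} h2 := IH bigl.
apply: (@leq_trans (q.-1 * (n * pair_total true false l) + q * (n * pair_total true true l))).
  by rewrite -!(mulnCA n) -mulnDr leq_mul2l h orbT.
apply: (leq_trans (leq_add (leq_mul (leqnn _) h1) (leq_mul (leqnn _) h2))).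
rewrite -!(mulnCA N) -mulnDr leq_mul2l; apply/orP; right.
apply: (@leq_trans ((n + walk_err l) * q ^ (2 * l.+1) + 4 * n * l.+2 ^ 2 * q ^ l.+2 +
   n * (n * d) * q ^ l.+1)); last first.
  by rewrite !leq_add2r leq_mul2r leq_add2l walk_errS orbT.
have [r ->] := degree_pred.
have -> : 2 * l.+1 = (2 * l).+2 by lia.
rewrite !(expnS r.+1) /=; set X := r.+1 ^ (2 * l); set Y := r.+1 ^ l; set A := n + _.
have -> : A * (r.+1 * (r.+1 * X)) + 4 * n * l.+2 ^ 2 * (r.+1 * (r.+1 * Y)) +
    n * (n * d) * (r.+1 * Y) =
  r * (A * (r.+1 * X) + 4 * n * l.+1 * (r.+1 * Y)) +
  r.+1 * (A * X + 4 * n * l.+1 ^ 2 * (r.+1 * Y) + n * (n * d) * Y) +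
  4 * n * (r.+1 * (l.+2 * r.+1 + l.+1) * Y) by ring.
exact: leq_addr.
Qed.

(** The square of the mean in [zero_count_variance] cancels against the leading terms of the four
    pair counts. What is left comes from the closed walk error, from cycles of proper divisor length
    and from pairs of equal walks. *)
Lemma zero_count_total l : 8 * l.+1 + 4 * (d * d.+1) <= n -> 0 < n ->
  (\sum_(G : sgraph T | regular d G) zero_count G l.+2) * (d * q ^ l) <=
  N * n * (walk_err l * (d * q ^ l) + 4 * n * l.+2 ^ 2 + n ^ 2).
Proof.
move=> big n0; set X := q ^ l; set Z := \sum_(_ | _) _.
have d0 : 0 < d by lia.
have X0 : 0 < X by rewrite expn_gt0; apply/orP; left; lia.
have var : Z * (d * X) ^ 2 + N * (n ^ 2 * (d * X) ^ 2) <=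
   n * (n * (pair_total true true l + pair_total true false l +
      pair_total true false l + pair_total false false l)).
  rewrite [leqRHS]mulnA [in leqRHS]mulnn /Z big_distrl -sum_nat_cond_const -big_split /=.
  rewrite -[in X in _ <= _ * (_ + _ + X + _)]pair_total_sym /pair_total -!big_split big_distrr /=.
  apply: leq_sum => G reg; rewrite -sum_walk_count_sq.
  exact: zero_count_variance.
have := pair_total_tt big; have := pair_total_tf big; have := pair_total_ff big.
move: var; move: (pair_total true true l) (pair_total true false l) (pair_total false false l).
move=> tt tf ff var hff htf htt.
have E : q ^ l.+1 = q * X by rewrite expnS.
have E2 : q ^ (2 * l) = X ^ 2 by rewrite mulnC expnM.
have E3 : q ^ (2 * l).+1 = q * X ^ 2 by rewrite expnS E2.
have E4 : q ^ (2 * l.+1) = q ^ 2 * X ^ 2 by rewrite mulnC expnM E expnMn.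
rewrite E4 E in hff; rewrite E3 E in htf; rewrite E2 E in htt.
set A := n + walk_err l in hff htf htt.
have tot : n * (tt + tf + tf + ff) <=
    N * (A * (d * X) ^ 2 + 4 * n * l.+2 ^ 2 * (q * X) + n * (n * d) * X).
  have -> : n * (tt + tf + tf + ff) = n * tt + n * tf + n * tf + n * ff by ring.
  apply: leq_trans (leq_add (leq_add (leq_add htt htf) htf) hff) _.
  rewrite -!mulnDr leq_mul2l; apply/orP; right.
  (* The four leading coefficients [q ^ 2], [q], [q] and 1 add up to [(q + 1) ^ 2 = d ^ 2], exactly
     the square of the mean. *)
  have -> : (d * X) ^ 2 = (q ^ 2 + 2 * q + 1) * X ^ 2.
    by rewrite -{1}(prednK d0); ring.
  by apply: eq_leq; ring.
have {var}var : Z * (d * X) ^ 2 + N * (n ^ 2 * (d * X) ^ 2) <=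
  n * (N * (A * (d * X) ^ 2 + 4 * n * l.+2 ^ 2 * (q * X) + n * (n * d) * X)).
  by apply: leq_trans var _; rewrite leq_mul2l tot orbT.
have dX0 : 0 < d * X by rewrite muln_gt0 d0.
rewrite -(leq_pmul2r dX0).
have qd : N * n * (4 * n * l.+2 ^ 2) * (q * X) <= N * n * (4 * n * l.+2 ^ 2) * (d * X).
  by rewrite leq_mul2l leq_mul2r leq_pred !orbT.
move: var qd; rewrite /A.
have -> : n * (N * ((n + walk_err l) * (d * X) ^ 2 + 4 * n * l.+2 ^ 2 * (q * X) + n * (n * d) * X))
 = N * n * (walk_err l * (d * X) * (d * X)) + N * n * (4 * n * l.+2 ^ 2) * (q * X)
   + N * n * (n ^ 2) * (d * X) + N * (n ^ 2 * (d * X) ^ 2) by ring.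
rewrite leq_add2r => var qd.
have -> : Z * (d * X) * (d * X) = Z * (d * X) ^ 2 by ring.
apply: leq_trans var _.
have -> : N * n * (walk_err l * (d * X) + 4 * n * l.+2 ^ 2 + n ^ 2) * (d * X) =
  N * n * (walk_err l * (d * X) * (d * X)) + N * n * (4 * n * l.+2 ^ 2) * (d * X) +
  N * n * n ^ 2 * (d * X) by ring.
by rewrite !leq_add2r leq_add2l.
Qed.

End ExpectedZeroCount.

(** * Distances *)

Section Distances.
Variables (T : finType) (d : nat).
Local Notation n := #|T|.
Local Notation q := d.-1.
Implicit Types (G : sgraph T) (x y z w : T) (p s : seq T).

Lemma gdist_le_card G x y : gdist G x y <= n.
Proof. by rewrite /gdist -[leqRHS](size_iota 0) find_size. Qed.

Lemma gdist_path G x y p : path (adj G) x p -> last x p = y -> gdist G x y <= size p.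
Proof.
move=> pp lp; case: (leqP n (size p)) => [|lt]; first exact/leq_trans/gdist_le_card.
rewrite leqNgt; apply/negP => h; have := before_find 0 h.
rewrite nth_iota // add0n => /negbT/negP []; apply/existsP; exists (in_tuple p).
by rewrite /= pp lp eqxx.
Qed.

Lemma gdist_geodesic G x y : connect (adj G) x y ->
  exists p, [/\ path (adj G) x p, last x p = y, uniq (x :: p) & size p = gdist G x y].
Proof.
case/connectP => p pp ->; case: (shortenP pp) => p' pp' up' _.
have sz : size p' < n by rewrite -[X in X <= _](card_uniqP up') max_card.
have h : has (walk_of_length G x (last x p')) (iota 0 n).
  apply/hasP; exists (size p'); first by rewrite mem_iota.
  by apply/existsP; exists (in_tuple p'); rewrite /= pp' eqxx.
have lt : gdist G x (last x p') < n by rewrite /gdist -[ltnRHS](size_iota 0) -has_find.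
have := nth_find 0 h; rewrite nth_iota // add0n => /existsP [r /andP [pr /eqP lr]].
case: (shortenP pr) lr => r' pr' ur' sub lr'; exists r'; split=> //.
apply/eqP; rewrite eqn_leq gdist_path // andbT -[leqRHS](size_tuple r).
by rewrite uniq_leq_size //; case/andP: ur'.
Qed.

Lemma gdist_disconnected G x y : ~~ connect (adj G) x y -> gdist G x y = n.
Proof.
move=> nc; rewrite /gdist hasNfind ?size_iota //; apply: contra nc => /hasP [k _].
by case/existsP => r /andP [pr /eqP <-]; apply/connectP; exists r.
Qed.

Lemma gdist_lt_connect G x y : gdist G x y < n -> connect (adj G) x y.
Proof. by apply: contraTT => /gdist_disconnected ->; rewrite ltnn. Qed.

(** For unreachable pairs the conventional value [n] is the largest possible one, which preserves
    the inequality. *)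
Lemma gdist_triangle G x y z : gdist G x z <= gdist G x y + gdist G y z.
Proof.
case: (boolP (connect (adj G) x y)) => [cxy|/gdist_disconnected ->]; last first.
  by rewrite (leq_trans (gdist_le_card _ _ _)) ?leq_addr.
case: (boolP (connect (adj G) y z)) => [cyz|/gdist_disconnected ->]; last first.
  by rewrite (leq_trans (gdist_le_card _ _ _)) ?leq_addl.
have [p [pp lp _ <-]] := gdist_geodesic cxy; have [r [pr lr _ <-]] := gdist_geodesic cyz.
by rewrite -size_cat; apply: gdist_path; rewrite ?cat_path ?last_cat lp ?pp.
Qed.

Lemma walk_count_gdist G x y k : 0 < walk_count G x y k.+1 -> gdist G x y <= k.
Proof.
rewrite lt0n; apply: contraR; rewrite -ltnNge => lt.
apply/eqP/big1 => s _; apply/eqP; rewrite eqb0; apply/negP => /and3P [/andP [ss _] hx ly].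
have := size_tuple s; case: (tval s) ss hx ly => // a p pp /eqP [ax] /eqP ly [sz].
move: lt; rewrite ltnNge -sz -ax (@gdist_path _ _ _ p) //.
by move: ly; case/lastP: p {pp sz} => [|p b] /=; rewrite ?rev_cons ?rev_rcons ?last_rcons => -[].
Qed.

(** A geodesic repeats no vertex, hence never backtracks; its [k] steps visit [k.+1] vertices. *)
Lemma gdist_walk_count G x y k : gdist G x y = k -> k < n -> 0 < walk_count G x y k.+1.
Proof.
move=> gk kn; have [|p [pp lp up sz]] := @gdist_geodesic G x y.
  by apply: gdist_lt_connect; rewrite gk.
have szt : size (x :: p) == k.+1 by rewrite /= sz gk.
rewrite /walk_count (bigD1 (Tuple szt)) //= /nbwalk /= pp eqxx /=.
have := uniq_nonback up => /= ->.
rewrite -[rev _]/(rev (x :: p)) (_ : ohead _ = Some y) ?eqxx //.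
by case/lastP: p lp {pp up sz szt} => [|p b]; rewrite ?rev_cons ?rev_rcons ?last_rcons /= => ->.
Qed.

Lemma gdist_gt_zero_count G l :
  \sum_x \sum_y (l.+1 < gdist G x y) <= zero_count G l.+2.
Proof.
rewrite /zero_count -sum_bool_card pair_big /=; apply: leq_sum => -[x y] _ /=.
case: (ltnP l.+1 (gdist G x y)) => // lt; rewrite lt0b.
by rewrite -leqn0 leqNgt; apply: contraL lt => /walk_count_gdist; rewrite -leqNgt.
Qed.

Lemma gdist_eq_count G l : regular d G -> l.+1 < n ->
  \sum_x \sum_y (gdist G x y == l.+1) <= n * d * q ^ l.
Proof.
move=> reg ln; rewrite -(sum_walk_count l reg); apply: leq_sum => x _.
by apply: leq_sum => y _; case: eqP => // e; apply: gdist_walk_count.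
Qed.

Lemma gdist_eq0_count G : 0 < n -> \sum_x \sum_y (gdist G x y == 0) <= n.
Proof.
move=> n0; rewrite -[leqRHS]muln1 -sum_nat_const; apply: leq_sum => x _.
rewrite (bigD1 x) //= big1 ?addn0 ?leq_b1 // => y yx; apply/eqP; rewrite eqb0.
apply: contra yx => /eqP g0; have [|p [_ lp _]] := @gdist_geodesic G x y.
  by apply: gdist_lt_connect; rewrite g0.
by rewrite g0 => /size0nil p0; rewrite -lp p0.
Qed.

Lemma arith_geom_sum m : 1 < q -> \sum_(l < m) (m - l) * q ^ l <= 2 * q ^ m.
Proof.
move=> q1; elim: m => [|m IH]; first by rewrite big_ord0.
have E : \sum_(l < m.+1) (m.+1 - l) * q ^ l =
         \sum_(l < m) (m - l) * q ^ l + \sum_(l < m.+1) q ^ l.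
  rewrite !big_ord_recr /= subSnn mul1n addnA -big_split /=; congr (_ + _).
  by apply: eq_bigr => l _; rewrite subSn 1?ltnW // mulSn addnC.
rewrite E; apply: leq_trans (leq_add IH (sum_expn_le m q1)) _.
by rewrite -mulnDl expnS mulnA leq_mul2r; apply/orP; right; lia.
Qed.

(** At most [n * d * q ^ l] pairs are at distance [l.+1], so the weighted sum is governed by the
    largest distances, where [q ^ D.-1 < n]; the diagonal adds at most [D * n <= n ^ 2]. *)
Lemma sum_gdist_below G D : regular d G -> 2 < d -> 0 < D -> q ^ D.-1 < n ->
  \sum_x \sum_y (D - gdist G x y) <= (2 * d + 1) * n ^ 2.
Proof.
move=> reg d3 D0 Dn.
have q1 : 1 < q by lia.
have Dln : D <= n.
  by rewrite -(prednK D0) (leq_ltn_trans _ Dn) // ltnW // ltn_expl.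
case: D D0 Dn Dln => // m _ /= mn Dln.
have E g : m.+1 - g = m.+1 * (g == 0) + \sum_(l < m) (m - l) * (g == l.+1).
  case: g => [|g]; first by rewrite subn0 muln1 big1 ?addn0 // => l _; rewrite muln0.
  rewrite muln0 add0n subSS; case: (ltnP g m) => gm.
    rewrite (bigD1 (Ordinal gm)) //= eqxx muln1 big1 ?addn0 // => l /negbTE lg.
    by rewrite eqSS eq_sym -[g]/(nat_of_ord (Ordinal gm)) (inj_eq val_inj) lg muln0.
  rewrite big1 => [|l _]; first by apply/eqP; rewrite subn_eq0.
  by rewrite eqSS gtn_eqF ?muln0 // (leq_trans (ltn_ord l)).
have -> : \sum_x \sum_y (m.+1 - gdist G x y) =
   m.+1 * (\sum_x \sum_y (gdist G x y == 0)) +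
   \sum_(l < m) (m - l) * (\sum_x \sum_y (gdist G x y == l.+1)).
  rewrite !pair_big /= big_distrr /=.
  under [X in _ = _ + X]eq_bigr do rewrite pair_big big_distrr /=.
  by rewrite [X in _ = _ + X]exchange_big -big_split; apply: eq_bigr => p _; apply: E.
apply: (@leq_trans (m.+1 * n + \sum_(l < m) (m - l) * (n * d * q ^ l))).
  apply: leq_add; first by rewrite leq_mul2l gdist_eq0_count ?orbT // (leq_ltn_trans _ mn).
  apply: leq_sum => l _; rewrite leq_mul2l gdist_eq_count ?orbT //.
  by apply: leq_trans Dln; rewrite ltnS.
under eq_bigr do rewrite mulnCA.
rewrite -big_distrr /=.
apply: (@leq_trans (n * n + n * d * (2 * n))).
  apply: leq_add; first by rewrite leq_mul2r Dln orbT.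
  rewrite leq_mul2l; apply/orP; right; apply: leq_trans (arith_geom_sum m q1) _.
  by rewrite leq_mul2l /= ltnW.
by apply: eq_leq; ring.
Qed.

Definition far_pairs G D := #|[set p : T * T | 2 * D < gdist G p.1 p.2]|.

(** Up to [2 * D], the excess over [D] is the number of thresholds [l.+1] from [D] to [2 * D - 1]
    below the distance, and an exceeded threshold means that there is no walk of [l.+1] steps.
    Beyond [2 * D] the crude bound [M] is used. *)
Lemma sum_gdist_above G D M : 0 < D ->
  (forall x y, gdist G x y <= M) ->
  \sum_x \sum_y (gdist G x y - D) <=
  \sum_(D.-1 <= l < (2 * D).-1) zero_count G l.+2 + far_pairs G D * M.
Proof.
move=> D0 bM.
apply: (@leq_trans (\sum_x \sum_y (\sum_(D.-1 <= l < (2 * D).-1) (l.+1 < gdist G x y) +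
    (2 * D < gdist G x y) * M))).
  apply: leq_sum => x _; apply: leq_sum => y _; move: (bM x y).
  move: (gdist G x y) => g gM; case: (ltnP (2 * D) g) => h.
    by rewrite mul1n; apply: leq_trans (leq_addl _ _); apply: leq_trans gM; apply: leq_subr.
  rewrite addn0; case: (leqP g D) => gD.
    by rewrite (eqP (_ : g - D == 0)) // subn_eq0.
  rewrite (@big_cat_nat _ _ _ g.-1) /=; try lia.
  apply: leq_trans (leq_addr _ _).
  rewrite big_nat (eq_bigr (fun=> 1)) => [|l /andP [_ lg]]; last first.
    by rewrite (_ : _ < _) //; lia.
  by rewrite -big_nat sum_nat_const_nat; lia.
under eq_bigr do rewrite big_split /= -big_distrl exchange_big /=.
rewrite big_split /= -big_distrl exchange_big /=.
apply: leq_add; last by rewrite /far_pairs -sum_bool_card pair_big.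
by apply: leq_sum => l _; apply: gdist_gt_zero_count.
Qed.

(** On a longer geodesic every one of the first [h] vertices is at distance more than [2 * D] from
    every one of the last [h], which makes [h ^ 2] far pairs. *)
Lemma gdist_far_pairs G D h x y : connect (adj G) x y -> far_pairs G D < h ^ 2 ->
  gdist G x y <= 2 * D + 2 * h.
Proof.
move=> cxy; apply: contraTT; rewrite -ltnNge -leqNgt => lt.
have [p [pp lp up sz]] := gdist_geodesic cxy.
set m := gdist G x y in lt sz.
pose v i := nth x (x :: p) i.
have vinj i j : i <= m -> j <= m -> v i = v j -> i = j.
  by move=> im jm /eqP; rewrite nth_uniq //= ?sz ?ltnS // => /eqP.
have dfrom i : i <= m -> gdist G x (v i) <= i.
  move=> im; rewrite (leq_trans (@gdist_path G x (v i) (take i p) _ _)) //.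
  - by move: pp; rewrite -{1}(cat_take_drop i p) cat_path => /andP [].
  - case: i im => [|i] im; first by rewrite take0.
    by rewrite (take_nth x) ?sz // last_rcons.
  by rewrite size_take; case: ltnP.
have dto i : i <= m -> gdist G (v i) y <= m - i.
  move=> im; rewrite (leq_trans (@gdist_path G (v i) y (drop i p) _ _)) //.
  - have lt' : last x (take i p) = v i.
      case: i im => [|i] im; first by rewrite take0.
      by rewrite (take_nth x) ?sz // last_rcons.
    by move: pp; rewrite -{1}(cat_take_drop i p) cat_path lt' => /andP [].
  - have lt' : last x (take i p) = v i.
      case: i im => [|i] im; first by rewrite take0.
      by rewrite (take_nth x) ?sz // last_rcons.
    by rewrite -lt' -last_cat cat_take_drop.
  by rewrite size_drop sz.
have far i j : i < h -> j < h -> 2 * D < gdist G (v i) (v (m - j)).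
  move=> ih jh; have h1 := gdist_triangle G x (v i) y.
  have h2 := gdist_triangle G (v i) (v (m - j)) y.
  have h3 : gdist G x (v i) <= i by apply: dfrom; lia.
  have h4 : gdist G (v (m - j)) y <= m - (m - j) by apply: dto; lia.
  move: h1 h2 h3 h4; rewrite -/m; lia.
pose f (ij : 'I_h * 'I_h) := (v ij.1, v (m - ij.2)).
have finj : injective f.
  move=> [i j] [i' j'] [e1 e2]; have := ltn_ord i; have := ltn_ord i'.
  have := ltn_ord j; have := ltn_ord j' => hj' hj hi' hi.
  have e1' := vinj _ _ _ _ e1; have e2' := vinj _ _ _ _ e2.
  by congr (_, _); apply: val_inj => /=; [apply: e1'|]; lia.
rewrite -[leqLHS](_ : #|[set: 'I_h * 'I_h]| = _); last first.
  by rewrite cardsT card_prod card_ord mulnn.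
rewrite -(card_imset _ finj); apply/subset_leq_card/subsetP => _ /imsetP [[i j] _ ->].
by rewrite inE; apply: far.
Qed.

Definition closed_set G (S : {set T}) := [forall x in S, forall y, adj G x y ==> (y \in S)].

Lemma closed_setP G (S : {set T}) :
  reflect (forall x y, x \in S -> adj G x y -> y \in S) (closed_set G S).
Proof.
apply: (iffP forallP) => [h x y xS xy|h x].
  by move: (h x) => /implyP /(_ xS) /forallP /(_ y) /implyP; apply.
by apply/implyP => xS; apply/forallP => y; apply/implyP; apply: h.
Qed.

Lemma closed_setC G S : closed_set G S -> closed_set G (~: S).
Proof.
move/closed_setP => h; apply/closed_setP => x y; rewrite !inE => + xy.
by apply: contra => yS; apply: h yS _; rewrite adj_sym.
Qed.

Lemma closed_connect G S x y : closed_set G S -> x \in S -> connect (adj G) x y -> y \in S.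
Proof.
move=> /closed_setP cl xS /connectP [p pp ->]; elim: p x xS pp => //= a p IH x xS /andP [xa].
by apply: IH; apply: cl xa.
Qed.

(** Take the smaller of a component and its complement. Pairs across have the conventional distance
    [n > 2 * D], and the larger side has at least [n / 2] vertices. *)
Lemma small_closed_set G D : ~~ connected_graph G -> 2 * D < n ->
  exists S : {set T}, [/\ S != set0, closed_set G S & #|S| * n <= 2 * far_pairs G D].
Proof.
move=> nconn Dn.
have /forallPn [x /forallPn [y nxy]] := nconn.
pose S := [set z | connect (adj G) x z].
have clS : closed_set G S.
  by apply/closed_setP => a b; rewrite !inE => xa /connect1; apply: connect_trans.
have xS : x \in S by rewrite inE connect0.
have yS : y \in ~: S by rewrite !inE.
have key A : closed_set G A -> 2 * #|A| <= n -> #|A| * n <= 2 * far_pairs G D.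
  move=> clA sA; have : #|A| * #|~: A| <= far_pairs G D.
    rewrite -cardsX; apply/subset_leq_card/subsetP => -[a b].
    rewrite !inE /= => /andP [aA bA]; rewrite gdist_disconnected //.
    by apply: contra bA; apply: closed_connect.
  by rewrite -(cardsC A) in sA *; nia.
case: (leqP (2 * #|S|) n) => h.
  by exists S; split; [apply/set0Pn; exists x| |apply: key].
exists (~: S); split; [by apply/set0Pn; exists y|exact: closed_setC|].
by apply: key; [exact: closed_setC|have := cardsC S; lia].
Qed.

End Distances.

Lemma max3_med3 (p q r D a b c : nat) :
  p <= D + a -> q <= D + b -> r <= D + c -> D <= p + a -> D <= q + b -> D <= r + c ->
  max3 p q r <= med3 p q r + (a + b + c).
Proof.
rewrite /max3 /med3 /sort /=.
by case: (leqP p q) => ? //=; case: (leqP q r) => ? //=; case: (leqP p r) => ? //=; lia.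
Qed.

(** * Small closed sets *)

Lemma bin_le_expn m k : 'C(m, k) <= m ^ k.
Proof.
apply: (@leq_trans (m ^_ k)); first by rewrite -bin_ffact leq_pmulr ?fact_gt0.
elim: k m => [|k IH] [|m] //; rewrite ffactSS expnS leq_mul2l /=.
by rewrite (leq_trans (IH m)) //; case: k {IH} => // k; rewrite leq_exp2r.
Qed.

Section SmallClosedSets.
Variables (T : finType) (d : nat).
Local Notation n := #|T|.
Local Notation N := #|[set G : sgraph T | regular d G]|.
Implicit Types (G : sgraph T) (H : {set {set T}}) (S : {set T}).

(** The edges of [H] are prescribed one after the other, each with conditional probability at most
    [2 * d / n]. *)
Lemma regs_expn H : 0 < d -> 2 * (2 * #|H| + 2 * (d * d.+1)) <= n * d ->
  n ^ #|H| * #|regs d H| <= (2 * d) ^ #|H| * N.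
Proof.
move=> d0; move: {2}#|H| (erefl #|H|) => k; elim: k H => [|k IH] H Hk big.
  rewrite Hk !mul1n (cards0_eq Hk) subset_leq_card //.
  by apply/subsetP => G; rewrite !inE => /andP [].
(* If no regular graph contains [H] the bound is trivial; otherwise such a graph shows that the
   members of [H] are pairs. *)
have [->|/card_gt0P [G]] := posnP #|regs d H|; first by rewrite muln0.
rewrite inE => /andP [_ HG].
have /card_gt0P [e eH] : 0 < #|H| by rewrite Hk.
have /eqP/cards2P [u [v [uv eE]]] := card_edge (subsetP HG e eH).
have cH : #|H :\ e| = k by have := cardsD1 e H; rewrite eH; lia.
have eN : [set u; v] \notin H :\ e by rewrite eE !inE eqxx.
have sw := switching_crude d0 eN.
have {IH} := IH _ cH; rewrite cH in sw *; rewrite Hk in big * => IH.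
rewrite -eE (setD1K eH) in sw.
have {}sw : n * #|regs d H| <= 2 * d * #|regs d (H :\ e)| by apply: sw; lia.
have {}IH : n ^ k * #|regs d (H :\ e)| <= (2 * d) ^ k * N by apply: IH; lia.
rewrite !expnS [n * _]mulnC -mulnA.
apply: (@leq_trans (n ^ k * (2 * d * #|regs d (H :\ e)|))).
  by rewrite leq_mul2l sw orbT.
by rewrite mulnCA -[leqRHS]mulnA leq_mul2l IH orbT.
Qed.

Definition inner_pairs S : {set {set T}} := [set e : {set T} | (e \subset S) && (#|e| == 2)].

Lemma closed_set_edges G S : regular d G -> closed_set G S ->
  2 * #|edges G :&: inner_pairs S| = d * #|S|.
Proof.
move=> reg /closed_setP cl.
transitivity (\sum_(p : T * T | (p.1 \in S) && adj G p.1 p.2) 1); last first.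
  rewrite -(pair_big_dep (fun x => x \in S) (adj G) (fun _ _ => 1)) /=.
  rewrite (eq_bigr (fun=> d)) => [|x _]; last by rewrite sum1dep_card (card_nbr _ reg).
  by rewrite sum_nat_const mulnC.
rewrite (partition_big (fun p : T * T => [set p.1; p.2]) (mem (edges G :&: inner_pairs S))) /=.
  rewrite mulnC -sum_nat_const; apply: eq_bigr => e; rewrite !inE => /and3P [eG eS].
  case/cards2P => x [y [xy eE]]; subst e.
  rewrite sum1dep_card (_ : [set _ | _] = [set (x, y); (y, x)]).
    by rewrite cards2 -pair_eqE /= /pair_eq /= negb_and xy.
  apply/setP => -[a b]; rewrite !inE eq_set2 -!pair_eqE /pair_eq /=.
  apply/andP/orP => [[_ /orP //]|ab]; split; last by apply/orP.
  move/subsetP: eS => eS; have xS : x \in S by apply: eS; rewrite !inE eqxx.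
  have yS : y \in S by apply: eS; rewrite !inE eqxx orbT.
  by case: ab => /andP [/eqP -> /eqP ->]; rewrite ?xS ?yS // adj_sym.
move=> [x y] /= /andP [xS xy]; rewrite !inE; apply/and3P; split=> //.
  by apply/subsetP => z; rewrite !inE => /orP [] /eqP ->; rewrite ?(cl _ _ xS xy).
by rewrite (card_edge xy).
Qed.

(** A closed set spans exactly [h = d * #|S| / 2] edges, and the union bound runs over at most
    [(#|S| ^ 2) ^ h] candidates for them. Squaring removes the half from the exponents. *)
Lemma closed_set_count S : 0 < d -> 2 * (d * #|S| + 2 * (d * d.+1)) <= n * d ->
  #|[set G | regular d G && closed_set G S]| ^ 2 * n ^ (d * #|S|) <=
  N ^ 2 * (2 * d * #|S| ^ 2) ^ (d * #|S|).
Proof.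
move=> d0 big; set A := [set G | _].
pose h := (d * #|S|)./2.
have [->|/card_gt0P [G0]] := posnP #|A|; first by rewrite mul0n.
rewrite inE => /andP [reg0 cl0].
have hE : d * #|S| = 2 * h by rewrite /h -(closed_set_edges reg0 cl0) !mul2n doubleK.
pose Hs := [set H : {set {set T}} | H \subset inner_pairs S & #|H| == h].
have AE : #|A| <= \sum_(H in Hs) #|regs d H|.
  rewrite (eq_bigr (fun H => \sum_(G in regs d H) 1)) => [|H _]; last by rewrite sum1_card.
  rewrite (exchange_big_dep xpredT) //= -sum1_card big_mkcond /=; apply: leq_sum => G _.
  rewrite inE; case: ifP => // /andP [reg cl].
  rewrite (bigD1 (edges G :&: inner_pairs S)) //= !inE reg subsetIl subsetIr /=.
  by rewrite andbT -(@eqn_pmul2l 2) // (closed_set_edges reg cl) hE.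
have cHs : #|Hs| <= (#|S| ^ 2) ^ h.
  rewrite /Hs cards_draws (leq_trans (bin_le_expn _ _)) //.
  case: (posnP h) => [->|h0] //; rewrite leq_exp2r //.
  by rewrite /inner_pairs cards_draws bin_le_expn.
have key : #|A| * n ^ h <= N * (2 * d * #|S| ^ 2) ^ h.
  apply: (@leq_trans (\sum_(H in Hs) (2 * d) ^ h * N)).
    apply: (@leq_trans ((\sum_(H in Hs) #|regs d H|) * n ^ h)).
      by rewrite leq_mul2r AE orbT.
    rewrite big_distrl /=; apply: leq_sum => H; rewrite inE => /andP [_ /eqP Hh].
    by rewrite mulnC -Hh regs_expn // Hh -hE.
  rewrite sum_nat_const [in leqRHS]expnMn [leqRHS]mulnC -mulnA mulnCA.
  by rewrite leq_mul // leq_mul.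
by rewrite hE !(mulnC 2 h) !expnM -!expnMn leq_exp2r.
Qed.


(** As [d >= 3], [closed_set_count] provides a factor [n ^ (3 * s)] against a squared cardinal. Of
    it, [n ^ (2 * s)] gives the factor [n ^ s] wanted here, and the remaining [n ^ s] absorbs
    [W ^ 2 * (2 * d * s ^ 2) ^ (d * s)]. *)
Lemma closed_set_rare s0 W S : 2 < d -> S != set0 -> #|S| <= s0 ->
  2 * (d * s0 + 2 * (d * d.+1)) <= n * d ->
  W ^ 2 * (2 * d * s0 ^ 2) ^ d <= n ->
  W * #|[set G | regular d G && closed_set G S]| * n ^ #|S| <= N.
Proof.
move=> d3 S0 Ss0 big nW; set A := #|_|; set s := #|S|.
have d0 : 0 < d by lia.
have n0 : 0 < n by rewrite lt0n; apply/eqP => n0; move: big; rewrite n0; lia.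
have spos : 0 < s by rewrite card_gt0.
have bigs : 2 * (d * #|S| + 2 * (d * d.+1)) <= n * d.
  by apply: leq_trans big; rewrite leq_mul2l leq_add2r leq_mul2l Ss0 orbT.
have := closed_set_count d0 bigs; rewrite -/A -/s => cnt.
have [W0|W0] := posnP W; first by rewrite W0.
have pw : W ^ 2 * (2 * d * s ^ 2) ^ (d * s) <= n ^ s.
  apply: (@leq_trans ((W ^ 2 * (2 * d * s0 ^ 2) ^ d) ^ s)); last by rewrite leq_exp2r.
  rewrite (expnMn (W ^ 2)) -(expnM (2 * d * s0 ^ 2)); apply: leq_mul.
    by rewrite -[leqLHS]expn1 leq_pexp2l // expn_gt0 W0.
  by rewrite leq_exp2r ?muln_gt0 ?d0 // leq_mul2l leq_exp2r // Ss0 orbT.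
have n3 : n ^ (3 * s) <= n ^ (d * s) by rewrite leq_pexp2l // leq_mul2r d3 orbT.
rewrite -(@leq_exp2r _ _ 2) //.
have ns0 : 0 < n ^ s by rewrite expn_gt0 n0.
rewrite -(leq_pmul2r ns0).
have -> : (W * A * n ^ s) ^ 2 * n ^ s = W ^ 2 * (A ^ 2 * n ^ (3 * s)).
  by rewrite [3 * s]mulnC expnM; ring.
apply: (@leq_trans (W ^ 2 * (A ^ 2 * n ^ (d * s)))).
  by rewrite !leq_mul2l n3 !orbT.
apply: (@leq_trans (W ^ 2 * (N ^ 2 * (2 * d * s ^ 2) ^ (d * s)))).
  by rewrite leq_mul2l cnt orbT.
by rewrite mulnCA leq_mul2l pw orbT.
Qed.

(** There are at most [n ^ i] sets of size [i], so by [closed_set_rare] each size from 1 to [s0]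
    contributes at most [N / W]. *)
Lemma small_closed_sets_rare s0 W : 2 < d ->
  2 * (d * s0 + 2 * (d * d.+1)) <= n * d ->
  W ^ 2 * (2 * d * s0 ^ 2) ^ d <= n ->
  W * #|[set G | regular d G &&
          [exists S : {set T}, [&& S != set0, closed_set G S & #|S| <= s0]]]| <= s0 * N.
Proof.
move=> d3 big nW; set B := [set G | _].
have n0 : 0 < n.
  by rewrite lt0n; apply/eqP => n0; move: big; rewrite n0; lia.
pose A S := #|[set G | regular d G && closed_set G S]|.
pose P := [pred S : {set T} | (S != set0) && (#|S| <= s0)].
have BE : #|B| <= \sum_(S | P S) A S.
  rewrite (eq_bigr (fun S => \sum_(G | regular d G && closed_set G S) 1)); last first.
    by move=> S _; rewrite sum1dep_card.
  rewrite (exchange_big_dep xpredT) //= -sum1_card big_mkcond /=; apply: leq_sum => G _.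
  rewrite inE; case: ifP => // /andP [reg /existsP [S /and3P [S0 cl Ss]]].
  by rewrite (bigD1 S) //= ?S0 ?Ss ?reg ?cl.
apply: (@leq_trans (W * \sum_(S | P S) A S)); first by rewrite leq_mul2l BE orbT.
pose f (S : {set T}) : 'I_s0.+1 := inord #|S|.
rewrite (partition_big f (fun i => 0 < i)) /=; last first.
  by move=> S /andP [S0 Ss]; rewrite /f inordK ?ltnS // card_gt0.
rewrite big_distrr /=.
apply: (@leq_trans (\sum_(i < s0.+1 | 0 < i) N)); last first.
  by rewrite big_mkcond big_ord_recl /= add0n sum_nat_const card_ord.
apply: leq_sum => i i0.
have ni0 : 0 < n ^ i by rewrite expn_gt0 n0.
rewrite -(leq_pmul2r ni0) -mulnA big_distrl big_distrr /=.
apply: (@leq_trans (\sum_(S : {set T} | #|S| == i) N)).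
  rewrite [leqLHS]big_mkcond [leqRHS]big_mkcond /=; apply: leq_sum => S _.
  case: ifP => // /andP [/andP [S0 Ss] /eqP fi].
  have Si : #|S| = i by rewrite -fi /f inordK.
  by rewrite Si eqxx mulnA -Si; apply: closed_set_rare nW.
rewrite sum_nat_cond_const mulnC leq_mul2l; apply/orP; right.
rewrite (leq_trans _ (bin_le_expn n i)) // -cardsT -cards_draws.
by apply/subset_leq_card/subsetP => S; rewrite !inE subsetT.
Qed.

End SmallClosedSets.

(** * Existence of regular graphs *)

Section Circulant.
Variables (m : nat) (C : {set 'I_m.+1}).
Hypotheses (C0 : ord0 \notin C) (Cs : forall x, x \in C -> (- x)%R \in C).
Implicit Types x y : 'I_m.+1.

Definition circulant_edges : {set {set 'I_m.+1}} :=
  [set [set p.1; p.2] | p in [set p : 'I_m.+1 * 'I_m.+1 | (p.2 - p.1)%R \in C]].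

Lemma circulant_simple : [forall e in circulant_edges, #|e| == 2].
Proof.
apply/forallP => e; apply/implyP => /imsetP [[x y]]; rewrite inE /= => xy ->.
rewrite cards2 eqSS eqb1; apply: contraNneq C0 => E.
by move: xy; rewrite E GRing.subrr.
Qed.

Definition circulant := SGraph circulant_simple.

Lemma circulant_adj x y : adj circulant x y = ((y - x)%R \in C).
Proof.
apply/imsetP/idP => [[[a b]]|xy]; last by exists (x, y); rewrite ?inE.
rewrite inE /= => ab /eqP; rewrite eq_set2 => /orP [] /andP [/eqP -> /eqP ->] //.
by rewrite -GRing.opprB; apply: Cs.
Qed.

Lemma circulant_regular : regular #|C| circulant.
Proof.
apply/forallP => x; apply/eqP.
rewrite -[RHS](card_imset (pred_of_set C) (@GRing.addIr _ x)); apply: eq_card => y.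
rewrite inE circulant_adj; apply/idP/imsetP => [h|[c cC ->]].
  by exists (y - x)%R; rewrite ?GRing.subrK.
by rewrite GRing.addrK.
Qed.

End Circulant.

(** A circulant graph on the integers modulo [n], with steps from 1 to [d./2] and their opposites;
    for odd [d] the number [n] is even and the self-opposite step [n./2] is added. *)
Lemma regular_graph_exists n d : d < n -> ~~ odd (n * d) ->
  exists G : sgraph 'I_n, regular d G.
Proof.
case: n => // m dm par.
suff [C [C0 Cs cC]] : exists C : {set 'I_m.+1},
    [/\ ord0 \notin C, forall x, x \in C -> (- x)%R \in C & #|C| = d].
  by exists (circulant C0); rewrite -cC; apply: circulant_regular.
have [k kE] : exists k, d./2 = k by exists d./2.
have k2 : 2 * k <= d by lia.
pose f (j : 'I_k) : 'I_m.+1 := inord j.+1.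
have fE j : f j = j.+1 :> nat by rewrite /f inordK //; have := ltn_ord j; lia.
pose A := f @: [set: 'I_k].
have AP x : (x \in A) = (0 < x <= k).
  apply/imsetP/idP => [[j _ ->]|/andP [x0 xk]]; first by rewrite fE ltn_ord.
  have xk' : x.-1 < k by lia.
  by exists (Ordinal xk') => //; apply: val_inj; rewrite /= fE /=; lia.
have cA : #|A| = k.
  rewrite card_imset ?cardsT ?card_ord // => i j /(congr1 val); rewrite /= !fE.
  by case=> /val_inj.
have oppE (x : 'I_m.+1) : 0 < x -> (- x)%R = m.+1 - x :> nat.
  by move=> x0; rewrite /= modn_small //; have := ltn_ord x; lia.
pose B := [set (- x)%R | x in A].
have BP x : (x \in B) = (m.+1 - k <= x).
  apply/imsetP/idP => [[y yA ->]|h].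
    by move: yA; rewrite AP => /andP [y0 yk]; rewrite oppE //; lia.
  have x0 : 0 < x by lia.
  exists (- x)%R; last by rewrite GRing.opprK.
  by rewrite AP oppE //; have := ltn_ord x; lia.
have cB : #|B| = k by rewrite card_imset //; apply: GRing.oppr_inj.
have cAB : #|A :|: B| = 2 * k.
  rewrite cardsU (_ : A :&: B = set0) ?cards0; first by rewrite cA cB subn0 addnn mul2n.
  by apply/setP => x; rewrite !inE AP BP; lia.
have symAB x : x \in A :|: B -> (- x)%R \in A :|: B.
  rewrite !inE => /orP [xA|/imsetP [y yA ->]]; last by rewrite GRing.opprK yA.
  by rewrite (imset_f _ xA) orbT.
have [od|ev] := boolP (odd d); last first.
  exists (A :|: B); split=> //; first by rewrite inE AP BP /=; lia.
  by rewrite cAB -kE mul2n -[RHS]odd_double_half (negbTE ev).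
have hm : m.+1./2 < m.+1 by lia.
pose h : 'I_m.+1 := Ordinal hm.
have mev : ~~ odd m.+1 by move: par; rewrite oddM od andbT.
exists (h |: (A :|: B)); split.
- by rewrite !inE AP BP -val_eqE /=; lia.
- move=> x; rewrite in_setU1 => /orP [/eqP ->|/symAB xAB]; last by rewrite in_setU1 xAB orbT.
  rewrite in_setU1; apply/orP; left; apply/eqP/val_inj; rewrite [LHS]oppE //=; lia.
- rewrite cardsU1 cAB !inE AP BP /= -[RHS]odd_double_half od -kE mul2n.
  by rewrite (_ : ~~ _) //; lia.
Qed.

(** * Asymptotics *)

Lemma markov_count (I : finType) (P : pred I) (f : I -> nat) c :
  c * #|[set i | P i && (c < f i)]| <= \sum_(i | P i) f i.
Proof.
rewrite mulnC -sum_nat_cond_const [leqRHS]big_mkcond [leqLHS]big_mkcond /=.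
by apply: leq_sum => i _; case: (P i) => //=; case: ltnP => // /ltnW.
Qed.

Definition poly_bounded (F : nat -> nat) := exists K a, forall D, F D <= K * D.+1 ^ a.

Lemma poly_const c : poly_bounded (fun=> c).
Proof. by exists c, 0 => D; rewrite muln1. Qed.

Lemma poly_id : poly_bounded id.
Proof. by exists 1, 1 => D; rewrite mul1n ltnW. Qed.

Lemma poly_mul F1 F2 : poly_bounded F1 -> poly_bounded F2 ->
  poly_bounded (fun D => F1 D * F2 D).
Proof.
move=> [K1 [a1 h1]] [K2 [a2 h2]]; exists (K1 * K2), (a1 + a2) => D.
by rewrite expnD mulnACA leq_mul.
Qed.

Lemma poly_add F1 F2 : poly_bounded F1 -> poly_bounded F2 ->
  poly_bounded (fun D => F1 D + F2 D).
Proof.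
move=> [K1 [a1 h1]] [K2 [a2 h2]]; exists (K1 + K2), (a1 + a2) => D.
rewrite expnD mulnDl; apply: leq_add.
  by apply: leq_trans (h1 D) _; rewrite mulnA leq_pmulr // expn_gt0.
by apply: leq_trans (h2 D) _; rewrite mulnCA leq_pmull // expn_gt0.
Qed.

Lemma poly_expn F c : poly_bounded F -> poly_bounded (fun D => F D ^ c).
Proof.
move=> hF; elim: c => [|c IH]; first exact: poly_const.
by have [K [a h]] := poly_mul hF IH; exists K, a => D; rewrite expnS.
Qed.

Lemma poly_lt_exp F : poly_bounded F -> exists D0, forall D, D0 <= D -> F D <= 2 ^ D.-1.
Proof.
(* The spare factor [D.+1] in [D.+1 ^ b] later absorbs [2 * K * M]. The constant [M] arises from
   [D.+1 <= 2 * b * (D %/ b)] and [D %/ b < 2 ^ (D %/ b)]. *)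
move=> [K [a h]]; pose b := a.+1.
pose M := (2 * b) ^ b.
exists (2 * K * M + 2 * b) => D hD; apply: leq_trans (h D) _.
have hM : D.+1 ^ b <= M * 2 ^ D.
  have e1 : D.+1 <= 2 * b * (D %/ b + 0).
    rewrite addn0; have := divn_eq D b; have := ltn_pmod D (ltn0Sn a).
    have : 2 <= D %/ b by rewrite leq_divRL //; lia.
    rewrite -/b; move: (D %/ b) (D %% b) => x y; nia.
  apply: (@leq_trans ((2 * b * (D %/ b)) ^ b)).
    by rewrite leq_exp2r // -[D %/ b]addn0.
  rewrite expnMn leq_mul2l; apply/orP; right.
  apply: (@leq_trans ((2 ^ (D %/ b)) ^ b)); first by rewrite leq_exp2r // ltnW // ltn_expl.
  by rewrite -expnM leq_exp2l // leq_trunc_div.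
have M0 : 0 < M by rewrite expn_gt0.
rewrite -(leq_pmul2l M0) -(@leq_pmul2l 2) //.
have D1 : 0 < D by lia.
have -> : 2 * (M * 2 ^ D.-1) = M * 2 ^ D by rewrite mulnCA -expnS prednK.
apply: leq_trans hM.
have -> : 2 * (M * (K * D.+1 ^ a)) = 2 * K * M * D.+1 ^ a by ring.
by rewrite expnS leq_mul2r; apply/orP; right; lia.
Qed.

(** * Deviation of the distances from [D], and connectedness, at a fixed scale *)

Section Core.
Variables (T : finType) (d : nat).
Local Notation n := #|T|.
Local Notation q := d.-1.
Local Notation N := #|[set G : sgraph T | regular d G]|.
Hypothesis d3 : 2 < d.

(** Dominates the polynomial errors of [zero_count_total] for all [l <= 2 * D] at once. *)
Definition err_at D := walk_err d (2 * D) + 4 * (2 * D + 2) ^ 2.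

Lemma walk_err_mono a b : a <= b -> walk_err d a <= walk_err d b.
Proof.
move=> ab; have : forall k, walk_err d a <= walk_err d (a + k).
  elim=> [|k IH]; first by rewrite addn0.
  by rewrite addnS (leq_trans IH) // walk_errS.
by move/(_ (b - a)); rewrite subnKC.
Qed.

(** Here [d * q ^ l] is at least [q ^ D * q ^ j >= n * q ^ j], so the term [n ^ 2] of
    [zero_count_total] is reduced to [n / q ^ j]. *)
Lemma zero_count_shifted D j : 0 < D -> j <= D -> n <= q ^ D ->
  16 * D + 4 * (d * d.+1) <= n -> 0 < n ->
  q ^ j * (\sum_(G : sgraph T | regular d G) zero_count G (D.-1 + j).+2) <=
  N * n * (q ^ j * err_at D + n).
Proof.
move=> D0 jD nq big n0; set l := D.-1 + j.
have lD : l <= 2 * D by rewrite /l; lia.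
have bigl : 8 * l.+1 + 4 * (d * d.+1) <= n by rewrite /l; lia.
have := zero_count_total d3 bigl n0; set Z := \sum_(_ | _) _; set X := d * q ^ l => h.
have d0 : 0 < d by lia.
have q0 : 0 < q by lia.
have X0 : 0 < X by rewrite muln_gt0 d0 expn_gt0 q0.
have XE : q ^ D * q ^ j <= X.
  rewrite -expnD (_ : D + j = l.+1); last by rewrite /l; lia.
  by rewrite expnS leq_mul2r leq_pred orbT.
have nX : n <= X.
  by apply: leq_trans XE; apply: leq_trans nq _; rewrite leq_pmulr // expn_gt0 q0.
rewrite -(leq_pmul2r X0) -mulnA.
apply: (@leq_trans (q ^ j * (N * n * (walk_err d l * X + 4 * n * l.+2 ^ 2 + n ^ 2)))).
  by rewrite leq_mul2l h orbT.
rewrite mulnCA -[leqRHS]mulnA leq_mul2l; apply/orP; right.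
rewrite mulnDr mulnDl; apply: leq_add; last first.
  by rewrite mulnCA leq_mul2l mulnC (leq_trans _ XE) ?orbT // leq_mul2r nq orbT.
rewrite -[leqRHS]mulnA leq_mul2l; apply/orP; right; rewrite /err_at mulnDl; apply: leq_add.
  by rewrite leq_mul2r walk_err_mono ?orbT.
rewrite mulnAC leq_mul //; rewrite leq_mul2l leq_exp2r //=; lia.
Qed.

Lemma sum_far_pairs D : 0 < D -> n <= q ^ D -> 16 * D + 4 * (d * d.+1) <= n -> 0 < n ->
  \sum_(G : sgraph T | regular d G) far_pairs G D <= N * n * (err_at D).+1.
Proof.
move=> D0 nq big n0; have h := zero_count_shifted D0 (leqnn D) nq big n0.
have qD0 : 0 < q ^ D by rewrite expn_gt0; apply/orP; left; lia.
rewrite -(leq_pmul2l qD0); apply: leq_trans (leq_trans h _).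
  rewrite leq_mul2l; apply/orP; right; apply: leq_sum => G _.
  rewrite /far_pairs -sum_bool_card -(pair_big xpredT xpredT (fun x y => 2 * D < gdist G x y : nat)) /=.
  have -> : 2 * D = (D.-1 + D).+1 by lia.
  exact: gdist_gt_zero_count.
rewrite mulnCA leq_mul2l; apply/orP; right.
by rewrite mulnS addnC leq_add2r.
Qed.

(** The terms [n / q ^ j] sum to at most [2 * n], and the [D] error terms to at most [n].
    Multiplying by [2 ^ D] keeps the powers [2 ^ (D - j)] integral. *)
Lemma sum_zero_counts D : 0 < D -> n <= q ^ D -> 16 * D + 4 * (d * d.+1) <= n -> 0 < n ->
  D * err_at D <= n ->
  \sum_(G : sgraph T | regular d G) \sum_(D.-1 <= l < (2 * D).-1) zero_count G l.+2 <=
  3 * N * n ^ 2.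
Proof.
move=> D0 nq big n0 En; rewrite exchange_big /=.
have -> : (2 * D).-1 = D.-1 + D by lia.
rewrite -{1}[D.-1]add0n big_addn addKn big_mkord -(@leq_pmul2l (2 ^ D)) ?expn_gt0 //.
have each (j : 'I_D) : 2 ^ D * \sum_(G : sgraph T | regular d G) zero_count G (j + D.-1).+2
    <= N * n * (2 ^ D * err_at D + 2 ^ (D - j) * n).
  have jD : j <= D by rewrite ltnW.
  have := zero_count_shifted D0 jD nq big n0; rewrite addnC; set Z := \sum_(_ | _) _ => h.
  have q2 : 1 < q by lia.
  have qj0 : 0 < q ^ j by rewrite expn_gt0; apply/orP; left; lia.
  rewrite -(leq_pmul2l qj0) mulnCA.
  apply: (@leq_trans (2 ^ D * (N * n * (q ^ j * err_at D + n)))).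
    by rewrite leq_mul2l h orbT.
  rewrite mulnCA [leqRHS]mulnCA leq_mul2l; apply/orP; right.
  rewrite mulnDr [leqRHS]mulnDr; apply: leq_add; first by apply: eq_leq; rewrite mulnCA.
  rewrite mulnA leq_mul2r; apply/orP; right.
  rewrite -{1}(subnKC jD) expnD leq_mul2r; apply/orP; right.
  by case: (nat_of_ord j) => // j'; rewrite leq_exp2r.
rewrite big_distrr /=; apply: leq_trans (leq_sum _ (fun j _ => each j)) _.
rewrite -big_distrr big_split /= sum_nat_const card_ord -big_distrl /=.
have geo : \sum_(j < D) 2 ^ (D - j) <= 2 * 2 ^ D.
  rewrite (reindex_inj rev_ord_inj) /=.
  rewrite (eq_bigr (fun j : 'I_D => 2 * 2 ^ j)) => [|j _]; last first.
    by rewrite -expnS; congr (_ ^ _); have := ltn_ord j; lia.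
  rewrite -big_distrr leq_mul2l /=.
  elim: (D) => [|D' IH]; first by rewrite big_ord0.
  by rewrite big_ord_recr /= expnS mul2n -addnn leq_add2r.
have -> : 2 ^ D * (3 * N * n ^ 2) = N * n * (2 ^ D * n + 2 * 2 ^ D * n) by ring.
rewrite leq_mul2l; apply/orP; right; apply: leq_add; last by rewrite leq_mul2r geo orbT.
by rewrite mulnCA leq_mul2l En orbT.
Qed.

Definition dist_dev (G : sgraph T) D :=
  \sum_x \sum_y ((D - gdist G x y) + (gdist G x y - D)).

Lemma dist_dev_bound (G : sgraph T) D K P : regular d G -> connected_graph G -> 0 < D ->
  q ^ D.-1 < n -> 0 < P -> 64 * P ^ 3 + 4 * P * D <= n ->
  \sum_(D.-1 <= l < (2 * D).-1) zero_count G l.+2 <= K * n ^ 2 ->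
  far_pairs G D <= n * P ->
  dist_dev G D <= (2 * d + 2 + K) * n ^ 2.
Proof.
move=> reg conn D0 qn P0 big hZ hB.
(* Large enough for [n * P < h ^ 2], which bounds all distances by [2 * D + 2 * h], and small enough
   for the at most [n * P] far pairs to contribute at most [n ^ 2]. *)
pose h := n %/ (4 * P).
have P40 : 0 < 4 * P by lia.
have hP : h * (4 * P) <= n by apply: leq_trunc_div.
have hP2 : n < (h.+1) * (4 * P) by apply: ltn_ceil.
have h1 : 0 < h by rewrite divn_gt0 //; apply: leq_trans big; nia.
have nh : n * P < h ^ 2.
  have h8 : n < 8 * P * h by nia.
  have h64 : n * n < 64 * P ^ 2 * h ^ 2.
    have -> : 64 * P ^ 2 * h ^ 2 = (8 * P * h) * (8 * P * h) by ring.
    by apply: ltn_mul.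
  have h64' : 64 * P ^ 2 * (n * P) <= n * n.
    have -> : 64 * P ^ 2 * (n * P) = n * (64 * P ^ 3) by ring.
    by rewrite leq_mul2l (leq_trans (leq_addr _ _) big) orbT.
  rewrite -(@ltn_pmul2l (64 * P ^ 2)) ?muln_gt0 ?expn_gt0 ?P0 //.
  exact: leq_ltn_trans h64' h64.
have bM x y : gdist G x y <= 2 * D + 2 * h.
  apply: gdist_far_pairs; last exact: leq_ltn_trans hB nh.
  by have /forallP /(_ x) /forallP := conn.
have BM : far_pairs G D * (2 * D + 2 * h) <= n ^ 2.
  apply: (@leq_trans (n * P * (2 * D + 2 * h))); first by rewrite leq_mul2r hB orbT.
  rewrite -mulnA -mulnn leq_mul2l; apply/orP; right.
  by have := leq_trans (leq_addl _ _) big; lia.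
rewrite /dist_dev; under eq_bigr do rewrite big_split /=.
rewrite big_split /=.
apply: leq_trans (leq_add (sum_gdist_below reg d3 D0 qn) (sum_gdist_above D0 bM)) _.
have -> : (2 * d + 2 + K) * n ^ 2 = (2 * d + 1) * n ^ 2 + (K * n ^ 2 + n ^ 2) by ring.
by rewrite leq_add2l leq_add.
Qed.

(** By Markov's inequality and [sum_far_pairs], more than [n * far_thr D] far pairs occur with
    probability at most [1 / D]. *)
Definition far_thr D := D * (err_at D).+1.

(** Three exceptional events: [A1], large zero counts, of probability at most [3 / K]; [A2], many
    far pairs, and [A3], a small closed set, of probability at most [1 / D] each. A disconnected
    graph is in [A2] or [A3]; a connected one with large deviation is in [A1] or [A2]. *)
Lemma core_bounds D K : 1 < D -> q ^ D.-1 < n -> n <= q ^ D ->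
  64 * far_thr D ^ 3 + 4 * far_thr D * D + 16 * D + 4 * (d * d.+1)
  + (2 * far_thr D * D) ^ 2 * (2 * d * (2 * far_thr D) ^ 2) ^ d <= n ->
  D * #|[set G : sgraph T | regular d G && ~~ connected_graph G]| <= 2 * N /\
  K * D * #|[set G : sgraph T | [&& regular d G, connected_graph G &
      (2 * d + 2 + K) * n ^ 2 < dist_dev G D]]| <= (3 * D + K) * N.
Proof.
move=> D1 qn nq; set P := far_thr D; set Big := (_ * _) ^ 2 * _ => big.
have D0 : 0 < D by rewrite ltnW.
have n0 : 0 < n by apply: leq_ltn_trans qn.
have P0 : 0 < P by rewrite /P /far_thr muln_gt0 D0.
have split5 a b c e f : a + b + c + e + f <= n ->
  [/\ a + b <= n, c + e <= n, f <= n, b <= n & b + e <= n] by clear; move=> h; split; lia.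
have {split5} [bigP big16 bigW bigPD bigPd] := split5 _ _ _ _ _ big.
have PD : 4 * P <= 4 * P * D by rewrite leq_pmulr.
pose A2 := [set G : sgraph T | regular d G && (n * P < far_pairs G D)].
pose A3 := [set G : sgraph T | regular d G &&
   [exists S : {set T}, [&& S != set0, closed_set G S & #|S| <= 2 * P]]].
pose A1 := [set G : sgraph T | regular d G &&
   (K * n ^ 2 < \sum_(D.-1 <= l < (2 * D).-1) zero_count G l.+2)].
have b2 : D * #|A2| <= N.
  have := markov_count (regular d) (fun G : sgraph T => far_pairs G D) (n * P).
  rewrite -/A2 => m; have := leq_trans m (sum_far_pairs D0 nq big16 n0).
  rewrite /P /far_thr.
  have -> : n * (D * (err_at D).+1) * #|A2| = D * #|A2| * (n * (err_at D).+1) by ring.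
  by rewrite -[leqRHS]mulnA leq_pmul2r // muln_gt0 n0.
have b3 : D * #|A3| <= N.
  have c1 : 2 * (d * (2 * P) + 2 * (d * d.+1)) <= n * d.
    have : 4 * P + 4 * d.+1 <= n.
      apply: leq_trans bigPd; apply: leq_add => //.
      by rewrite leq_mul2l /= leq_pmull // ltnW // ltnW.
    move/(leq_mul)/(_ (leqnn d)); apply: leq_trans.
    by apply: eq_leq; ring.
  (* The choice [s0 = 2 * P], [W = 2 * P * D] makes [s0 / W] equal to [1 / D]. *)
  have c2 : (2 * P * D) ^ 2 * (2 * d * (2 * P) ^ 2) ^ d <= n by [].
  have := small_closed_sets_rare d3 c1 c2; rewrite -/A3 -mulnA leq_pmul2l //.
  by rewrite muln_gt0.
have b1 : K * #|A1| <= 3 * N.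
  have := markov_count (regular d)
    (fun G : sgraph T => \sum_(D.-1 <= l < (2 * D).-1) zero_count G l.+2) (K * n ^ 2).
  rewrite -/A1 => m.
  have En : D * err_at D <= n.
    have : D * err_at D <= P by rewrite leq_mul2l leqnSn orbT.
    move/leq_trans; apply; apply: leq_trans bigPD; apply: leq_trans PD.
    by rewrite leq_pmull.
  have := leq_trans m (sum_zero_counts D0 nq big16 n0 En).
  have -> : K * n ^ 2 * #|A1| = K * #|A1| * n ^ 2 by ring.
  by rewrite leq_pmul2r // expn_gt0 n0.
split.
  apply: (@leq_trans (D * (#|A2| + #|A3|))); last by rewrite mulnDr mul2n -addnn leq_add.
  rewrite leq_mul2l; apply/orP; right; apply: leq_trans (leq_card_setU A2 A3).
  apply/subset_leq_card/subsetP => G; rewrite !inE => /andP [reg nconn].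
  rewrite reg /=; case: ltnP => //= hB; apply/existsP.
  have Dn : 2 * D < n.
    by apply: leq_trans (leq_trans (leq_addr _ _) big16); rewrite ltn_mul2r D0.
  have [S [S0 clS SB]] := small_closed_set nconn Dn.
  exists S; rewrite S0 clS /= -(leq_pmul2r n0) (leq_trans SB) //.
  by rewrite -mulnA leq_mul2l [P * n]mulnC.
apply: (@leq_trans (K * D * (#|A1| + #|A2|))).
  rewrite leq_mul2l; apply/orP; right; apply: leq_trans (leq_card_setU A1 A2).
  apply/subset_leq_card/subsetP => G; rewrite !inE => /and3P [reg conn].
  rewrite reg /=; apply: contraTT; rewrite negb_or -!leqNgt => /andP [hZ hB].
  exact: dist_dev_bound hB.
rewrite mulnDr mulnDl; apply: leq_add.
  by rewrite [K * D]mulnC [3 * D]mulnC -!(mulnA D) leq_mul2l b1 orbT.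
by rewrite -mulnA leq_mul2l b2 orbT.
Qed.

End Core.

Lemma eq_poly_bounded F1 F2 : F1 =1 F2 -> poly_bounded F1 -> poly_bounded F2.
Proof. by move=> E [K [a h]]; exists K, a => D; rewrite -E. Qed.

Lemma err_at_poly d : poly_bounded (err_at d).
Proof.
have lin a b : poly_bounded (fun D => a * D + b).
  by apply: poly_add; [apply: poly_mul; [exact: poly_const|exact: poly_id]|exact: poly_const].
apply: poly_add; last first.
  by apply: poly_mul; [exact: poly_const|apply: poly_expn; exact: lin].
apply: poly_add.
  apply: poly_mul; first exact: poly_const.
  by apply: poly_expn; apply: eq_poly_bounded (lin 4 3) => D; lia.
by apply: eq_poly_bounded (lin 16 (8 + 4 * (d * d.+1))) => D; lia.
Qed.

Lemma far_thr_poly d : poly_bounded (far_thr d).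
Proof.
apply: poly_mul; first exact: poly_id.
apply: (@eq_poly_bounded (fun D => err_at d D + 1)); first by move=> D; rewrite addn1.
by apply: poly_add; [exact: err_at_poly|exact: poly_const].
Qed.

(** The scale is [D = up_log q n]. Once it exceeds [M], the probabilities of order [1 / D] are of
    order [1 / M]; [K] and [M] stay free for the final choice of errors. *)
Lemma regular_graph_bounds d K M : 2 < d -> exists n0, forall n, n0 <= n -> ~~ odd (n * d) ->
  let N := #|[set G : sgraph 'I_n | regular d G]| in
  [/\ 0 < n, 0 < N,
     M * #|[set G : sgraph 'I_n | regular d G && ~~ connected_graph G]| <= 2 * N &
     exists D, K * M * #|[set G : sgraph 'I_n | [&& regular d G, connected_graph G &
      (2 * d + 2 + K) * n ^ 2 < dist_dev G D]]| <= (3 * M + K) * N].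
Proof.
move=> d3.
have pc c := poly_const c; have pP := far_thr_poly d; have pI := poly_id.
have pF : poly_bounded (fun D =>
    64 * far_thr d D ^ 3 + 4 * far_thr d D * D + 16 * D + 4 * (d * d.+1)
    + (2 * far_thr d D * D) ^ 2 * (2 * d * (2 * far_thr d D) ^ 2) ^ d).
  by do ?[exact: poly_const|exact: poly_id|exact: far_thr_poly
         |apply: poly_add|apply: poly_expn|apply: poly_mul].
have [D0 hD0] := poly_lt_exp pF.
set q := d.-1; have q2 : 1 < q by rewrite /q; lia.
(* The power of [q] forces [D > D0 + M + 2], the summand [d] gives [d < n] for
   [regular_graph_exists], and the two successors give [1 < n]. *)
exists (q ^ (D0 + M + 2) + d).+2 => n nn par N.
have n1 : 1 < n by lia.
have [qn nq] := andP (up_log_bounds q2 n1); set D := up_log q n in qn nq.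
have Dbig : D0 + M + 2 < D.
  have : q ^ (D0 + M + 2) < q ^ D by apply: leq_trans nq; lia.
  by rewrite ltn_exp2l.
have big : 64 * far_thr d D ^ 3 + 4 * far_thr d D * D + 16 * D + 4 * (d * d.+1)
    + (2 * far_thr d D * D) ^ 2 * (2 * d * (2 * far_thr d D) ^ 2) ^ d <= #|'I_n|.
  rewrite card_ord; apply: leq_trans (hD0 D _) _; first by lia.
  by apply: leq_trans (ltnW qn); rewrite leq_exp2r //; lia.
have D1 : 1 < D by lia.
have qn' : q ^ D.-1 < #|'I_n| by rewrite card_ord.
have nq' : #|'I_n| <= q ^ D by rewrite card_ord.
have [conn avg] := core_bounds d3 K D1 qn' nq' big; rewrite card_ord in avg.
split.
- by lia.
- by have [|G reg] := regular_graph_exists _ par; [lia|apply/card_gt0P; exists G; rewrite inE].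
- by apply: leq_trans conn; rewrite leq_mul2r; apply/orP; right; lia.
exists D; have D00 : 0 < D by lia.
rewrite -(leq_pmul2l D00).
have MD : M <= D by lia.
move: avg; rewrite -/N; move: #|_| => b avg.
apply: (@leq_trans (M * ((3 * D + K) * N))).
  have -> : D * (K * M * b) = M * (K * D * b) by ring.
  by rewrite leq_mul2l avg orbT.
have -> : M * ((3 * D + K) * N) = (3 * M * D + M * K) * N by ring.
have -> : D * ((3 * M + K) * N) = (3 * M * D + D * K) * N by ring.
by rewrite leq_mul2r leq_add2l leq_mul2r MD !orbT.
Qed.

(** * Average hyperbolicity and the limit *)

Lemma sum_dev4 (T : finType) (f : T -> T -> nat) :
  \sum_x \sum_y \sum_z \sum_w
    ((f x y + f z w) + (f x z + f y w) + (f x w + f y z)) =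
  6 * (#|T| ^ 2 * \sum_x \sum_y f x y).
Proof.
set S := \sum_x \sum_y f x y.
have c (F : nat) : \sum_(x : T) F = #|T| * F by rewrite sum_nat_const.
under eq_bigr do under eq_bigr do under eq_bigr do rewrite !big_split /=.
under eq_bigr do under eq_bigr do rewrite !big_split /=.
under eq_bigr do rewrite !big_split /=.
rewrite !big_split /=.
have -> : \sum_(x : T) \sum_(y : T) \sum_(z : T) \sum_(w : T) f x y = #|T| ^ 2 * S.
  rewrite /S !big_distrr /=; apply: eq_bigr => x _; rewrite big_distrr /=; apply: eq_bigr => y _.
  by rewrite !c; ring.
have -> : \sum_(x : T) \sum_(y : T) \sum_(z : T) \sum_(w : T) f z w = #|T| ^ 2 * S.
  by rewrite !c -/S; ring.
have -> : \sum_(x : T) \sum_(y : T) \sum_(z : T) \sum_(w : T) f x z = #|T| ^ 2 * S.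
  rewrite /S !big_distrr /=; apply: eq_bigr => x _; rewrite c !big_distrr /=; apply: eq_bigr => y _.
  by rewrite !c; ring.
have -> : \sum_(x : T) \sum_(y : T) \sum_(z : T) \sum_(w : T) f y w = #|T| ^ 2 * S.
  rewrite c /S !big_distrr /=; apply: eq_bigr => x _; rewrite c !big_distrr /=; apply: eq_bigr => y _.
  by ring.
have -> : \sum_(x : T) \sum_(y : T) \sum_(z : T) \sum_(w : T) f x w = #|T| ^ 2 * S.
  rewrite /S !big_distrr /=; apply: eq_bigr => x _; rewrite !c !big_distrr /=; apply: eq_bigr => y _.
  by ring.
have -> : \sum_(x : T) \sum_(y : T) \sum_(z : T) \sum_(w : T) f y z = #|T| ^ 2 * S.
  rewrite c /S !big_distrr /=; apply: eq_bigr => x _; rewrite !big_distrr /=; apply: eq_bigr => y _.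
  by rewrite c; ring.
ring.
Qed.

From mathcomp Require Import all_classical all_reals all_analysis.
Import Order.TTheory GRing.Theory Num.Theory.
Import numFieldNormedType.Exports.
Local Open Scope ring_scope.

Lemma fp_le (R : realType) (T : finType) (G : sgraph T) D x y z w :
  let dev x y := ((D - gdist G x y) + (gdist G x y - D))%N in
  fp R G x y z w <= 2^-1 * ((dev x y + dev z w) + (dev x z + dev y w)
                            + (dev x w + dev y z))%N%:R.
Proof.
rewrite /= /fp ler_wpM2l ?invr_ge0 ?ler0n // lerBlDl -natrD ler_nat.
(* Each of the three sums consists of two distances, hence is compared with [2 * D]. *)
by apply: (@max3_med3 _ _ _ (2 * D)); lia.
Qed.

(** Half of the sum of six deviations, each of mean at most [C], gives the constant [3 * C]. *)
Lemma avg_hyperbolicity_le (R : realType) (T : finType) (G : sgraph T) D C :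
  (0 < #|T|)%N -> (dist_dev G D <= C * #|T| ^ 2)%N ->
  avg_hyperbolicity R G <= (3 * C)%:R.
Proof.
move=> n0 hC; rewrite /avg_hyperbolicity ler_pdivrMr ?ltr0n ?expn_gt0 ?n0 //.
pose dev x y := ((D - gdist G x y) + (gdist G x y - D))%N.
apply: (@le_trans _ _ (\sum_(x : T) \sum_(y : T) \sum_(z : T) \sum_(w : T)
   2^-1 * ((dev x y + dev z w) + (dev x z + dev y w) + (dev x w + dev y z))%N%:R)).
  do 4![apply: ler_sum => ? _]; exact: fp_le.
under eq_bigr do under eq_bigr do under eq_bigr do rewrite -mulr_sumr -natr_sum.
under eq_bigr do under eq_bigr do rewrite -mulr_sumr -natr_sum.
under eq_bigr do rewrite -mulr_sumr -natr_sum.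
rewrite -mulr_sumr -natr_sum sum_dev4 -/(dist_dev G D) mulrC ler_pdivrMr ?ltr0n //.
rewrite -!natrM ler_nat.
apply: (@leq_trans (6 * (#|T| ^ 2 * (C * #|T| ^ 2)))%N); first by rewrite !leq_mul2l hC !orbT.
by apply: eq_leq; rewrite !expnS expn0; lia.
Qed.

(** Since [M > 3], at least half of the regular graphs are connected, so conditioning at most
    doubles the proportion [3 / K + 1 / M] of bad graphs. *)
Lemma rrg_prob_connected_ge (R : realType) n d (A : pred (sgraph 'I_n)) K M :
  (0 < K)%N -> (3 < M)%N ->
  let N := #|[set G : sgraph 'I_n | regular d G]| in
  (0 < N)%N ->
  (M * #|[set G : sgraph 'I_n | regular d G && ~~ connected_graph G]| <= 2 * N)%N ->
  (K * M * #|[set G : sgraph 'I_n | [&& regular d G, connected_graph G & ~~ A G]]|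
     <= (3 * M + K) * N)%N ->
  `|1 - rrg_prob_connected R d A| <= 6 / K%:R + 2 / M%:R.
Proof.
move=> K0 M3 N N0; rewrite /rrg_prob_connected /rrg_prob.
set c := #|[set G | _ && ~~ _]|; set b := #|[set G | [&& _, _ & _]]| => hc hb.
have NE : #|[pred G : sgraph 'I_n | regular d G]| = N.
  by apply: eq_card => G; rewrite !inE.
set a := #|_|; rewrite NE; set e := #|[pred G | regular d G & connected_graph G]|.
have eE : (e + c = N)%N.
  rewrite /N -(cardsID [set G | connected_graph G]); congr (_ + _)%N.
    by apply: eq_card => G; rewrite !inE.
  by apply: eq_card => G; rewrite !inE andbC.
have aE : (a + b = e)%N.
  have -> : e = #|[set G : sgraph 'I_n | regular d G && connected_graph G]|.
    by apply: eq_card => G; rewrite !inE.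
  rewrite -(cardsID [set G | A G]); congr (_ + _)%N.
    by apply: eq_card => G; rewrite !inE; case: (A G); rewrite ?andbT ?andbF.
  by apply: eq_card => G; rewrite !inE; case: (A G); rewrite ?andbT ?andbF.
have Ne : (N <= 2 * e)%N by nia.
have e0 : (0 < e)%N by lia.
have e0R : (0 : R) < e%:R by rewrite ltr0n.
have N0R : (N%:R : R) != 0 by rewrite pnatr_eq0 -lt0n.
have -> : 1 - a%:R / N%:R / (e%:R / N%:R) = b%:R / e%:R :> R.
  have -> : b%:R = e%:R - a%:R :> R by rewrite -aE natrD addrC addKr.
  by field; rewrite N0R (gt_eqF e0R).
rewrite ger0_norm ?divr_ge0 ?ler0n // ler_pdivrMr //.
have K0R : (0 : R) < K%:R by rewrite ltr0n.
have M0R : (0 : R) < M%:R by rewrite ltr0n; lia.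
have : K%:R * M%:R * b%:R <= (3 * M%:R + K%:R) * N%:R :> R.
  by rewrite -!natrM -natrD -natrM ler_nat.
have : N%:R <= 2 * e%:R :> R by rewrite -natrM ler_nat.
move: (K%:R) (M%:R) (b%:R) (N%:R) (e%:R) K0R M0R e0R => k m b' N' e' k0 m0 e0' h1 h2.
have -> : (6 / k + 2 / m) * e' = ((3 * m + k) * (2 * e')) / (k * m).
  by field; rewrite !gt_eqF.
rewrite ler_pdivlMr ?mulr_gt0 // mulrC; apply: le_trans h2 _.
by rewrite ler_wpM2l // addr_ge0 ?mulr_ge0 ?ler0n // ltW.
Qed.

Local Open Scope classical_set_scope.

Theorem theorem5p2 (R : realType) (d : nat) (hd : (3 <= d)%N)
    (omega : nat -> R) (homega : omega n @[n --> \oo] --> +oo)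
    (eps : R) (heps : 0 < eps) :
  rrg_prob_connected R d [pred G : sgraph 'I_n | avg_hyperbolicity R G <= eps * omega n]
    @[n --> within [set n : nat | ~~ odd (n * d)] \oo] --> (1 : R).
Proof.
apply/cvgrPdist_le => eta eta0; have {}eta0 : (0 : R) < eta by [].
(* [M] and then [K] are chosen so that both error terms of [rrg_prob_connected_ge] are at most
   [eta / 2]. *)
have [M M3 hM] : exists2 M, (3 < M)%N & 4 / eta <= M%:R.
  exists (Num.trunc (4 / eta)).+4 => //.
  apply: ltW; apply: lt_le_trans (truncnS_gt _) _.
  by rewrite ler_nat; exact: (leq_addl 3).
have [K K0 hK] : exists2 K, (0 < K)%N & 12 / eta <= K%:R.
  by exists (Num.trunc (12 / eta)).+1 => //; apply: ltW; apply: truncnS_gt.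
have [n0 hn0] := regular_graph_bounds K M hd.
rewrite near_withinE.
(* [K] is fixed by [eta] before [n] varies, so the bound on the average hyperbolicity is a constant,
   which [eps * omega n] eventually exceeds. *)
have om : \forall n \near \oo, (3 * (2 * d + 2 + K))%:R / eps <= omega n.
  by move/cvgryPge: homega; apply.
near=> n => /= par.
have nn0 : (n0 <= n)%N by near: n; exact: nbhs_infty_ge.
have [npos N0 conn [D dev]] := hn0 n nn0 par.
have avg_big : (3 * (2 * d + 2 + K))%:R <= eps * omega n.
  by rewrite [leRHS]mulrC -ler_pdivrMr //; near: n.
apply: (le_trans (@rrg_prob_connected_ge R n d _ K M K0 M3 N0 conn _)).
  apply: leq_trans dev; rewrite leq_mul2l; apply/orP; right.
  apply/subset_leq_card/fintype.subsetP => G; rewrite !inE => /and3P [-> -> hA] /=.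
  rewrite ltnNge; apply: contra hA => hdev; apply: le_trans avg_big.
  by apply: (@avg_hyperbolicity_le R _ G D); rewrite card_ord.
have K0R : (0 : R) < K%:R by rewrite ltr0n.
have M0R : (0 : R) < M%:R by rewrite ltr0n; lia.
have h1 : 6 / K%:R <= eta / 2.
  rewrite ler_pdivrMr //; move: hK; rewrite ler_pdivrMr // => hK; lra.
have h2 : 2 / M%:R <= eta / 2.
  rewrite ler_pdivrMr //; move: hM; rewrite ler_pdivrMr // => hM; lra.
by rewrite (splitr eta); apply: lerD.
Unshelve. all: by end_near. Qed.
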